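(* Let $K$ be a field of characteristic $p>0$, let $R$ be a standard graded $K$-algebra, and let $m=\bigoplus_{i>0}R_i$. (1) Suppose that $R$ is reduced and $K$ is perfect. If $N_M^*=N_M^F$ for all finitely generated graded $R$-modules $N\subseteq M$ such that $M/N$ is $m$-coprimary, then $N_M^*=N_M^F$ for all finitely generated (not necessarily graded) $R$-modules $N\subseteq M$ such that $M/N$ is $m$-coprimary. (2) Suppose that $R$ is a domain and $K$ is algebraically closed. If $N_M^*=N_M^+=N_M^{+\mathrm{gr}}$ for all finitely generated graded $R$-modules $N\subseteq M$ such that $M/N$ is $m$-coprimary, then $N_M^*=N_M^+=N_M^{+\mathrm{gr}}$ for all finitely generated (not necessarily graded) $R$-modules $N\subseteq M$ such that $M/N$ is $m$-coprimary.
   Context: All rings are commutative with identity. A standard graded $K$-algebra is an $\mathbb{N}$-graded ring $R=\bigoplus_{i\ge0}R_i$ with $R_0=K$ that is finitely generated over $K$ by elements of degree $1$. A graded $R$-module is a $\mathbb{Z}$-graded $R$-module; for graded modules $N\subseteq M$ the submodule $N$ is a graded (homogeneous) submodule. A finitely generated $R$-module $Q$ is $m$-coprimary if it is killed by some power of the maximal ideal $m$. Let $q=p^e$ denote a power of $p$. Let $F^e:R\to R$, $r\mapsto r^q$, and for an $R$-module $M$ let $\mathbf{F}^e(M)=S\otimes_R M$ where $S$ is $R$ viewed as an $R$-module via $F^e$; since $S=R$ as a ring, $\mathbf{F}^e(M)$ is an $R$-module. For $u\in M$ write $u^q=1\otimes u\in\mathbf{F}^e(M)$, and for $N\subseteq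 M$ put $N_M^{[q]}=\mathrm{Im}(\mathbf{F}^e(N)\to\mathbf{F}^e(M))$. Let $R^\circ$ be the complement in $R$ of the union of the minimal primes. Tight closure: $N_M^*$ is the set of $u\in M$ for which there is $c\in R^\circ$ with $cu^q\in N_M^{[q]}$ for all $q\gg1$. Frobenius closure: $N_M^F=\{u\in M: u^q\in N_M^{[q]}\text{ for some }q\}$. For a domain $R$, $R^+$ is the integral closure of $R$ in an algebraic closure of its fraction field. For an $\mathbb{N}$-graded domain $R$, $R^{+\mathrm{GR}}$ is a maximal direct limit of module-finite, $\mathbb{Q}_{\ge0}$-graded extension domains of $R$ (with gradings extending that of $R$); concretely, it is the subring of $R^+$ generated by the elements $f$ satisfying, for some $\delta\in\mathbb{Q}_{\ge0}$, a monic equation $f^t+r_1f^{t-1}+\cdots+r_t=0$ with each $r_i\in R$ zero or homogeneous of degree $i\delta$; such $f$ is homogeneous of degree $\delta$. $R^{+\mathrm{gr}}$ is the $\mathbb{N}$-graded subring of $R^{+\mathrm{GR}}$ consisting of the components of integer degree; it is a direct summand of $R^{+\mathrm{GR}}$ as an $R^{+\mathrm{gr}}$-module. Plus closure: $N_M^+=\{u\in M: 1\otimes u\in\mathrm{Im}(R^+\otimes_R N\to R^+\otimes_R M)\}$. Graded-plus closure: $N_M^{+\mathrm{gr}}=\{u\in M: 1\otimes u\in\mathrm{Im}(S\otimes_R N\to S\otimes_R M)\}$ with $S=R^{+\mathrm{GR}}$ or $S=R^{+\mathrm{gr}}$ (the two choices give the same closure). *)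

(* Defs.v *)
From HB Require Import structures.
From mathcomp Require Import all_boot all_order all_algebra.
From mathcomp Require Import generic_quotient ring_quotient fraction freeg.
From mathcomp Require Import boolp classical_sets.

Set Implicit Arguments.
Unset Strict Implicit.
Unset Printing Implicit Defensive.

Import GRing.Theory.

Local Open Scope ring_scope.
Local Open Scope quotient_scope.

(* Submodules and subrings are boolean predicates; by [boolp] every
   closed [set] is one of them. *)
Record submod (R : nzRingType) (M : lmodType R) (N : submodClosed M) :=
  Submod { submod_val : M; _ : submod_val \in N }.

HB.instance Definition _ (R : nzRingType) (M : lmodType R)
  (N : submodClosed M) := [isSub for @submod_val R M N].
HB.instance Definition _ (R : nzRingType) (M : lmodType R)
  (N : submodClosed M) := [Choice of submod N by <:].
HB.instance Definition _ (R : nzRingType) (M : lmodType R)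
  (N : submodClosed M) := [SubChoice_isSubLmodule of submod N by <:].

Definition incl (R : nzRingType) (M : lmodType R) (N : submodClosed M) :
  {linear submod N -> M} := (\val : submod N -> M).

Record subring (R : comNzRingType) (S : subringClosed R) :=
  Subring { subring_val : R; _ : subring_val \in S }.

HB.instance Definition _ (R : comNzRingType) (S : subringClosed R) :=
  [isSub for @subring_val R S].
HB.instance Definition _ (R : comNzRingType) (S : subringClosed R) :=
  [Choice of subring S by <:].
HB.instance Definition _ (R : comNzRingType) (S : subringClosed R) :=
  [SubChoice_isSubComNzRing of subring S by <:].

Definition corestr (A R : comNzRingType) (f : {rmorphism A -> R})
  (S : subringClosed R) (fS : forall a, f a \in S) (a : A) : subring S :=
  Subring (fS a).

Fact corestr_zmod (A R : comNzRingType) (f : {rmorphism A -> R})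
  (S : subringClosed R) (fS : forall a, f a \in S) : zmod_morphism (@corestr A R f S fS).
Proof. by move=> a b; apply: val_inj; rewrite /= rmorphB. Qed.

Fact corestr_monoid (A R : comNzRingType) (f : {rmorphism A -> R})
  (S : subringClosed R) (fS : forall a, f a \in S) : monoid_morphism (@corestr A R f S fS).
Proof.
by split=> [|a b]; apply: val_inj; rewrite /= ?rmorph1 ?rmorphM.
Qed.

HB.instance Definition _ (A R : comNzRingType) (f : {rmorphism A -> R})
  (S : subringClosed R) (fS : forall a, f a \in S) :=
  GRing.isZmodMorphism.Build A (subring S) (@corestr A R f S fS)
    (@corestr_zmod A R f S fS).
HB.instance Definition _ (A R : comNzRingType) (f : {rmorphism A -> R})
  (S : subringClosed R) (fS : forall a, f a \in S) :=
  GRing.isMonoidMorphism.Build A (subring S) (@corestr A R f S fS)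
    (@corestr_monoid A R f S fS).

(* [submodClosed] is a structure over semimodules and does not provide the
   [zmodClosed] structure that [Quotient.quot] takes. *)
Definition submod_zmod (R : nzRingType) (M : lmodType R)
  (N : submodClosed M) : {pred M} := N.

Fact submod_zmod_closed (R : nzRingType) (M : lmodType R)
  (N : submodClosed M) : zmod_closed (submod_zmod N).
Proof.
split=> [|x y Nx Ny]; first exact: (rpred0 N).
by rewrite -scaleN1r; apply: (rpredD (S := N)) => //; apply: (rpredZ (s := N)).
Qed.

HB.instance Definition _ (R : nzRingType) (M : lmodType R)
  (N : submodClosed M) :=
  GRing.isZmodClosed.Build M (submod_zmod N) (submod_zmod_closed N).

Definition modquot (R : nzRingType) (M : lmodType R) (N : submodClosed M) :=
  Quotient.quot (submod_zmod N).

HB.instance Definition _ (R : nzRingType) (M : lmodType R)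
  (N : submodClosed M) := GRing.Zmodule.on (modquot N).
HB.instance Definition _ (R : nzRingType) (M : lmodType R)
  (N : submodClosed M) := Quotient.on (modquot N).

Definition modquot_pi (R : nzRingType) (M : lmodType R) (N : submodClosed M)
  (x : M) : modquot N := \pi x.

Definition modquot_scale (R : nzRingType) (M : lmodType R)
  (N : submodClosed M) (a : R) (x : modquot N) : modquot N :=
  modquot_pi N (a *: repr x).

Fact modquot_eqP (R : nzRingType) (M : lmodType R) (N : submodClosed M) x y :
  reflect (modquot_pi N x = modquot_pi N y) (x - y \in N).
Proof.
have -> : (x - y \in N) = (x - y \in submod_zmod N) by [].
by rewrite Quotient.idealrBE; apply: eqP.
Qed.

Fact modquot_pi_surj (R : nzRingType) (M : lmodType R) (N : submodClosed M)
  (x : modquot N) : modquot_pi N (repr x) = x.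
Proof. exact: reprK. Qed.

Fact modquot_pi_zmod (R : nzRingType) (M : lmodType R) (N : submodClosed M) :
  zmod_morphism (modquot_pi N).
Proof. exact: (raddfB (\pi_(Quotient.quot (submod_zmod N)))). Qed.

HB.instance Definition _ (R : nzRingType) (M : lmodType R)
  (N : submodClosed M) :=
  GRing.isZmodMorphism.Build M (modquot N) (modquot_pi N)
    (modquot_pi_zmod N).

Fact modquot_scale_pi (R : nzRingType) (M : lmodType R) (N : submodClosed M)
  a x : modquot_scale a (modquot_pi N x) = modquot_pi N (a *: x).
Proof.
apply/modquot_eqP; rewrite -scalerBr rpredZ //; apply/modquot_eqP.
exact: modquot_pi_surj.
Qed.

Fact modquot_scaleA (R : nzRingType) (M : lmodType R) (N : submodClosed M)
  a b (x : modquot N) :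
  modquot_scale a (modquot_scale b x) = modquot_scale (a * b) x.
Proof. by rewrite -[x]modquot_pi_surj !modquot_scale_pi scalerA. Qed.

Fact modquot_scale1 (R : nzRingType) (M : lmodType R) (N : submodClosed M) :
  left_id 1 (@modquot_scale R M N).
Proof.
by move=> x; rewrite -[x]modquot_pi_surj !modquot_scale_pi scale1r.
Qed.

Fact modquot_scaleDr (R : nzRingType) (M : lmodType R) (N : submodClosed M) :
  right_distributive (@modquot_scale R M N) +%R.
Proof.
move=> a x y; rewrite -[x]modquot_pi_surj -[y]modquot_pi_surj -raddfD.
by rewrite !modquot_scale_pi scalerDr raddfD.
Qed.

Fact modquot_scaleDl (R : nzRingType) (M : lmodType R) (N : submodClosed M)
  (x : modquot N) :
  {morph (@modquot_scale R M N)^~ x : a b / a + b}.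
Proof.
move=> a b; rewrite -[x]modquot_pi_surj.
by rewrite !modquot_scale_pi scalerDl raddfD.
Qed.

HB.instance Definition _ (R : nzRingType) (M : lmodType R)
  (N : submodClosed M) :=
  GRing.Zmodule_isLmodule.Build R (modquot N) (@modquot_scaleA R M N)
    (@modquot_scale1 R M N) (@modquot_scaleDr R M N) (@modquot_scaleDl R M N).

Fact modquot_pi_scalable (R : nzRingType) (M : lmodType R)
  (N : submodClosed M) : scalable (modquot_pi N).
Proof. by move=> a x; rewrite -modquot_scale_pi. Qed.

HB.instance Definition _ (R : nzRingType) (M : lmodType R)
  (N : submodClosed M) :=
  GRing.isScalable.Build R M (modquot N) *:%R (modquot_pi N)
    (@modquot_pi_scalable R M N).

Definition span (R : nzRingType) (M : lmodType R) (X : set M) : {pred M} :=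
  fun x => `[< forall N : submodClosed M, {in X, forall y, y \in N} ->
                 x \in N >].

Fact span_closed (R : nzRingType) (M : lmodType R) (X : set M) :
  submod_closed (span X).
Proof.
split=> [|a x y /asboolP hx /asboolP hy].
  by apply/asboolP => N _; apply: rpred0.
apply/asboolP => N XN; apply: (rpredD (S := N)); last exact: hy.
by apply: (rpredZ (s := N)); apply: hx.
Qed.

HB.instance Definition _ (R : nzRingType) (M : lmodType R) (X : set M) :=
  GRing.isSubmodClosed.Build R M (span X) (span_closed X).

Lemma mem_span (R : nzRingType) (M : lmodType R) (X : set M) x :
  X x -> x \in span X.
Proof. by move=> Xx; apply/asboolP => N; apply; rewrite inE. Qed.

(* S (x)_R M as the free S-module on M modulo the relations
   [m + n] = [m] + [n] and [r m] = phi(r) [m]; see [tensor_liftE] and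
   [tensor_lift_uniq] for the universal property. *)
Definition tensor_rel (R S : comNzRingType) (phi : {rmorphism R -> S})
  (M : lmodType R) : set {freeg M / S} :=
  [set D | (exists m n : M, D = << m + n >> - << m >> - << n >>) \/
           (exists (r : R) (m : M), D = << r *: m >> - phi r *: << m >>)].

Arguments tensor_rel {R S} phi M _.

Definition tensor (R S : comNzRingType) (phi : {rmorphism R -> S})
  (M : lmodType R) : lmodType S := modquot (span (tensor_rel phi M)).

Definition tens (R S : comNzRingType) (phi : {rmorphism R -> S})
  (M : lmodType R) (s : S) (m : M) : tensor phi M :=
  modquot_pi (span (tensor_rel phi M)) (s *: << m >>).

Definition tensor_lift (R S : comNzRingType) (phi : {rmorphism R -> S})
  (M : lmodType R) (Q : lmodType S) (g : M -> Q) (t : tensor phi M) : Q :=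
  fglift g (repr t).

Fact fglift_linear (S : comNzRingType) (M : choiceType) (Q : lmodType S)
  (g : M -> Q) : linear (fglift g : {freeg M / S} -> Q).
Proof.
have fgD D E : fglift g (D + E : {freeg M / S}) = fglift g D + fglift g E.
  have fgB := lift_is_additive g.
  have fg0 : fglift g (0 : {freeg M / S}) = 0.
    by have := fgB 0 0; rewrite !subrr.
  have fgN F : fglift g (- F : {freeg M / S}) = - fglift g F.
    by have := fgB 0 F; rewrite !sub0r fg0 sub0r.
  by rewrite -[E in LHS]opprK fgB fgN opprK.
move=> a D E; rewrite fgD; congr (_ + _).
elim/freeg_ind_dom0: D => [|k x D _ _ IH].
  have fg0 : fglift g (0 : {freeg M / S}) = 0.
    by have := fgD 0 0; rewrite addr0 -{1}[fglift g 0]addr0 => /addrI.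
  by rewrite scaler0 !fg0 scaler0.
rewrite scalerDr !fgD IH scalerDr; congr (_ + _).
have -> : a *: << k *g x >> = << a * k *g x >> :> {freeg M / S}.
  by apply/eqP/freeg_eqP => y; rewrite coeffZ !coeffU mulrA.
by rewrite !liftU scalerA.
Qed.

HB.instance Definition _ (S : comNzRingType) (M : choiceType)
  (Q : lmodType S) (g : M -> Q) :=
  GRing.isLinear.Build S {freeg M / S} Q *:%R (fglift g) (fglift_linear g).

Definition semilinear_for (R S : comNzRingType) (phi : {rmorphism R -> S})
  (M : lmodType R) (Q : lmodType S) (g : M -> Q) :=
  (forall m n, g (m + n) = g m + g n) /\
  (forall r m, g (r *: m) = phi r *: g m).

Definition fglift_ker (S : comNzRingType) (M : choiceType) (Q : lmodType S)
  (g : M -> Q) : {pred {freeg M / S}} := fun D => fglift g D == 0.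

Fact fglift_ker_closed (S : comNzRingType) (M : choiceType) (Q : lmodType S)
  (g : M -> Q) : submod_closed (fglift_ker g).
Proof.
split=> [|a D E /eqP hD /eqP hE]; apply/eqP; first exact: raddf0.
by rewrite linearP /= hD hE scaler0 addr0.
Qed.

HB.instance Definition _ (S : comNzRingType) (M : choiceType)
  (Q : lmodType S) (g : M -> Q) :=
  GRing.isSubmodClosed.Build S {freeg M / S} (fglift_ker g)
    (fglift_ker_closed g).

Fact tensor_lift_pi (R S : comNzRingType) (phi : {rmorphism R -> S})
  (M : lmodType R) (Q : lmodType S) (g : M -> Q) (D : {freeg M / S}) :
  semilinear_for phi g ->
  tensor_lift g (modquot_pi (span (tensor_rel phi M)) D : tensor phi M)
    = fglift g D.
Proof.
move=> [gD gZ]; apply/eqP; rewrite -subr_eq0 /tensor_lift -raddfB.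
have: repr (modquot_pi (span (tensor_rel phi M)) D) - D
    \in span (tensor_rel phi M) by apply/modquot_eqP; rewrite modquot_pi_surj.
move=> /asboolP /(_ (fglift_ker g)); apply => E; rewrite inE.
case=> [[m [n ->]]|[r [m ->]]]; apply/eqP.
  by rewrite !raddfB /= !liftU !scale1r gD addrAC addrK subrr.
by rewrite raddfB /= linearZ /= !liftU !scale1r gZ subrr.
Qed.

Lemma tensor_liftE (R S : comNzRingType) (phi : {rmorphism R -> S})
  (M : lmodType R) (Q : lmodType S) (g : M -> Q) s m :
  semilinear_for phi g -> tensor_lift g (tens phi s m) = s *: g m.
Proof.
move=> gl; rewrite /tens tensor_lift_pi //.
have -> : s *: << m >> = << s *g m >> :> {freeg M / S}.
  by apply/eqP/freeg_eqP => y; rewrite coeffZ !coeffU mulrA mulr1.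
by rewrite liftU.
Qed.

Lemma tensor_lift_linear (R S : comNzRingType) (phi : {rmorphism R -> S})
  (M : lmodType R) (Q : lmodType S) (g : M -> Q) :
  semilinear_for phi g -> linear (tensor_lift g : tensor phi M -> Q).
Proof.
move=> gl a x y; rewrite -[x]modquot_pi_surj -[y]modquot_pi_surj.
by rewrite -linearP !tensor_lift_pi // fglift_linear.
Qed.

Lemma tens_semilinear (R S : comNzRingType) (phi : {rmorphism R -> S})
  (M : lmodType R) : semilinear_for phi (tens phi 1 : M -> tensor phi M).
Proof.
split=> [m n|r m]; rewrite /tens !scale1r.
  rewrite -raddfD; apply/modquot_eqP; apply: mem_span; left.
  by exists m, n; rewrite opprD addrA.
by rewrite -linearZ; apply/modquot_eqP; apply: mem_span; right; exists r, m.
Qed.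

Lemma tens_scale (R S : comNzRingType) (phi : {rmorphism R -> S})
  (M : lmodType R) s (m : M) : tens phi s m = s *: tens phi 1 m.
Proof. by rewrite /tens scale1r -linearZ. Qed.

Lemma tensor_lift_uniq (R S : comNzRingType) (phi : {rmorphism R -> S})
  (M : lmodType R) (Q : lmodType S) (h k : {linear tensor phi M -> Q}) :
  (forall m, h (tens phi 1 m) = k (tens phi 1 m)) -> h =1 k.
Proof.
move=> hk t; rewrite -[t]modquot_pi_surj; move: (repr t) => D.
elim/freeg_ind_dom0: D => [|a m D _ _ IH].
  have -> : modquot_pi (span (tensor_rel phi M)) 0 = 0 :> tensor phi M.
    exact: raddf0.
  by rewrite !raddf0.
have -> : modquot_pi (span (tensor_rel phi M)) (<< a *g m >> + D)
    = tens phi a m + modquot_pi (span (tensor_rel phi M)) D :> tensor phi M.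
  rewrite raddfD /tens; congr (modquot_pi _ _ + _).
  by apply/eqP/freeg_eqP => y; rewrite coeffZ !coeffU mulrA mulr1.
by rewrite tens_scale !raddfD /= !linearZ /= hk IH.
Qed.

Definition tensor_map (R S : comNzRingType) (phi : {rmorphism R -> S})
  (N M : lmodType R) (f : {linear N -> M}) : tensor phi N -> tensor phi M :=
  tensor_lift (fun n => tens phi 1 (f n)).

Lemma tensor_mapE (R S : comNzRingType) (phi : {rmorphism R -> S})
  (N M : lmodType R) (f : {linear N -> M}) s n :
  tensor_map f (tens phi s n) = tens phi s (f n).
Proof.
have [gD gZ] := tens_semilinear phi M.
rewrite /tensor_map tensor_liftE -?tens_scale //.
by split=> [x y|r x]; rewrite ?raddfD ?linearZ /= ?gD ?gZ.
Qed.

Definition tensor_image (R S : comNzRingType) (phi : {rmorphism R -> S})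
  (M : lmodType R) (N : submodClosed M) : set (tensor phi M) :=
  range (tensor_map (incl N) : tensor phi (submod N) -> tensor phi M).

Arguments tensor_image {R S} phi {M} N _.

Definition extension_closure (R S : comNzRingType) (phi : {rmorphism R -> S})
  (M : lmodType R) (N : submodClosed M) : set M :=
  [set u | tensor_image phi N (tens phi 1 u)].

Arguments extension_closure {R S} phi {M} N _.

Definition frobenius (R : comNzRingType) (p : nat) (pR : p \in [pchar R])
  (e : nat) (r : R) : R := r ^+ (p ^ e).

Fact frobenius_zmod (R : comNzRingType) (p : nat) (pR : p \in [pchar R]) e :
  zmod_morphism (frobenius pR e).
Proof.
have pn : [pchar R].-nat (p ^ e)%N.
  by rewrite pnatX pnatE ?(pcharf_prime pR) ?pR.
have fD x y : frobenius pR e (x + y) = frobenius pR e x + frobenius pR e y.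
  exact: exprDn_pchar.
by move=> x y; apply/eqP; rewrite eq_sym subr_eq -fD subrK.
Qed.

Fact frobenius_monoid (R : comNzRingType) (p : nat) (pR : p \in [pchar R]) e :
  monoid_morphism (frobenius pR e).
Proof. by split=> [|x y]; rewrite /frobenius ?expr1n ?exprMn. Qed.

HB.instance Definition _ (R : comNzRingType) (p : nat)
  (pR : p \in [pchar R]) (e : nat) :=
  GRing.isZmodMorphism.Build R R (frobenius pR e) (frobenius_zmod pR e).
HB.instance Definition _ (R : comNzRingType) (p : nat)
  (pR : p \in [pchar R]) (e : nat) :=
  GRing.isMonoidMorphism.Build R R (frobenius pR e) (frobenius_monoid pR e).

(* The R-module structure is the one of the left factor, so that
   c u^q is [c *: frob_elt pR e u]. *)
Definition frob_functor (R : comNzRingType) (p : nat) (pR : p \in [pchar R])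
  (e : nat) (M : lmodType R) : lmodType R := tensor (frobenius pR e) M.

Definition frob_elt (R : comNzRingType) (p : nat) (pR : p \in [pchar R])
  (e : nat) (M : lmodType R) (u : M) : frob_functor pR e M :=
  tens (frobenius pR e) 1 u.

Definition frob_power (R : comNzRingType) (p : nat) (pR : p \in [pchar R])
  (e : nat) (M : lmodType R) (N : submodClosed M) :
  set (frob_functor pR e M) := tensor_image (frobenius pR e) N.

Arguments frob_power {R p} pR e {M} N _.

Definition minimal_prime (R : comNzRingType) (P : prime_idealr R) : Prop :=
  forall Q : prime_idealr R, {subset Q <= P} -> Q =i P.

(* The complement of the union of the minimal primes. *)
Definition ring_circ (R : comNzRingType) : set R :=
  [set c | forall P : prime_idealr R, minimal_prime P -> c \notin P].

Definition tight_closure (R : comNzRingType) (p : nat) (pR : p \in [pchar R])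
  (M : lmodType R) (N : submodClosed M) : set M :=
  [set u | exists c : R, ring_circ c /\ exists e0 : nat, forall e : nat,
     (e0 <= e)%N -> frob_power pR e N (c *: frob_elt pR e u)].

(* q ranges over the powers p^e, e >= 0. *)
Definition frobenius_closure (R : comNzRingType) (p : nat)
  (pR : p \in [pchar R]) (M : lmodType R) (N : submodClosed M) : set M :=
  [set u | exists e : nat, frob_power pR e N (frob_elt pR e u)].

Arguments tight_closure {R p} pR {M} N _.
Arguments frobenius_closure {R p} pR {M} N _.

Definition reduced_ring (R : nzRingType) : Prop :=
  forall (x : R) (n : nat), x ^+ n = 0 -> x = 0.

(* Perfectness of a field of characteristic p > 0. *)
Definition perfect_field (K : fieldType) (p : nat) : Prop :=
  forall x : K, exists y : K, y ^+ p = x.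

Definition fin_gen (R : nzRingType) (M : lmodType R) : Prop :=
  exists s : seq M, forall x : M, exists c : 'I_(size s) -> R,
    x = \sum_(i < size s) c i *: s`_i.

Definition homogeneous_sum (I : eqType) (V : zmodType) (A : I -> {pred V})
  (P : pred I) : set V :=
  [set x | exists (s : seq I) (f : I -> V),
     [/\ uniq s, all P s, forall i, f i \in A i & x = \sum_(i <- s) f i]].

Definition direct_sum (I : eqType) (V : zmodType) (A : I -> {pred V}) :=
  [/\ forall i, zmod_closed (A i),
      forall x, homogeneous_sum A predT x
    & forall (s : seq I) (f : I -> V), uniq s -> (forall i, f i \in A i) ->
        \sum_(i <- s) f i = 0 -> {in s, forall i, f i = 0}].

(* Finite generation by forms of degree 1 is [piece1_gen]: every K-subalgebra
   containing s is all of R. *)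
Record standard_grading (K : fieldType) (R : comAlgType K) := StandardGrading {
  piece :> nat -> {pred R};
  piece_direct : direct_sum piece;
  piece_mul : forall i j,
    {in piece i & piece j, forall x y, x * y \in piece (i + j)%N};
  piece0P : forall x, x \in piece 0%N <-> exists a : K, x = a%:A;
  piece1_gen : exists s : seq R, {subset s <= piece 1%N} /\
    forall A : subalgClosed R, {subset s <= A} -> forall x, x \in A
}.

Definition graded_module (K : fieldType) (R : comAlgType K)
  (G : standard_grading R) (M : lmodType R) (gM : int -> {pred M}) : Prop :=
  direct_sum gM /\
  forall (i : nat) (j : int),
    {in G i & gM j, forall r x, r *: x \in gM (i%:Z + j)}.

Definition graded_submod (R : nzRingType) (M : lmodType R)
  (gM : int -> {pred M}) (N : submodClosed M) : Prop :=
  forall x, x \in N ->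
    homogeneous_sum (fun i => [predI gM i & N]) predT x.

Definition irrelevant_ideal (K : fieldType) (R : comAlgType K)
  (G : standard_grading R) : set R := homogeneous_sum G (fun i => 0 < i)%N.

Definition ideal_power (R : comNzRingType) (I : set R) (k : nat) : set R :=
  [set x | exists (n : nat) (c : 'I_n -> R) (a : 'I_n -> 'I_k -> R),
     (forall i j, I (a i j)) /\ x = \sum_i c i * \prod_j a i j].

Definition coprimary (R : comNzRingType) (I : set R) (Q : lmodType R) :=
  exists k : nat, forall (r : R) (z : Q), ideal_power I k r -> r *: z = 0.

#[short(type="idomAlgType")]
HB.structure Definition IdomainAlgebra (K : nzRingType) :=
  {R of GRing.ComUnitAlgebra K R & GRing.IntegralDomain R}.

Definition algebraic_closure (F : fieldType) (L : closedFieldType)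
  (iota : {rmorphism F -> L}) : Prop := forall x : L, algebraicOver iota x.

(* R^+ and R^+GR are subrings of L, an algebraic closure of Frac R
   through iota. *)
Definition frac_emb (R : idomainType) (L : closedFieldType)
  (iota : {rmorphism {fraction R} -> L}) : {rmorphism R -> L} :=
  iota \o @tofrac R.

Definition plus_pred (R : idomainType) (L : closedFieldType)
  (iota : {rmorphism {fraction R} -> L}) : {pred L} :=
  fun x => `[< integralOver (frac_emb iota) x >].

Fact plus_pred_closed (R : idomainType) (L : closedFieldType)
  (iota : {rmorphism {fraction R} -> L}) : subring_closed (plus_pred iota).
Proof.
split=> [|x y /asboolP hx /asboolP hy|x y /asboolP hx /asboolP hy].
- by apply/asboolP; apply: integral1.
- by apply/asboolP; apply: integral_sub.
- by apply/asboolP; apply: integral_mul.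
Qed.

HB.instance Definition _ (R : idomainType) (L : closedFieldType)
  (iota : {rmorphism {fraction R} -> L}) :=
  GRing.isSubringClosed.Build L (plus_pred iota) (plus_pred_closed iota).

Fact frac_emb_plus (R : idomainType) (L : closedFieldType)
  (iota : {rmorphism {fraction R} -> L}) r : frac_emb iota r \in plus_pred iota.
Proof. by apply/asboolP; apply: integral_id. Qed.

Definition plus_emb (R : idomainType) (L : closedFieldType)
  (iota : {rmorphism {fraction R} -> L}) :
  {rmorphism R -> subring (plus_pred iota)} := corestr (frac_emb_plus iota).

Definition plus_closure (R : idomainType) (L : closedFieldType)
  (iota : {rmorphism {fraction R} -> L}) (M : lmodType R)
  (N : submodClosed M) : set M := extension_closure (plus_emb iota) N.

Arguments plus_closure {R L} iota {M} N _.

Definition zero_or_homogeneous (K : fieldType) (R : comAlgType K)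
  (G : standard_grading R) (d : rat) : set R :=
  [set r | r = 0 \/ exists n : nat, d = n%:R /\ r \in G n].

(* f^t + r_1 f^(t-1) + ... + r_t = 0 with r_i zero or of degree i d; there is
   no solution with t = 0. *)
Definition GR_homogeneous (K : fieldType) (R : idomAlgType K)
  (G : standard_grading R) (L : closedFieldType)
  (iota : {rmorphism {fraction R} -> L}) (d : rat) : set L :=
  [set f | exists (t : nat) (r : nat -> R),
     (forall i, (0 < i <= t)%N -> zero_or_homogeneous G (i%:R * d) (r i)) /\
     f ^+ t + \sum_(1 <= i < t.+1) frac_emb iota (r i) * f ^+ (t - i) = 0].

Definition subring_gen (A : nzRingType) (X : set A) : {pred A} :=
  fun x => `[< forall S : subringClosed A, {in X, forall y, y \in S} ->
                 x \in S >].

Fact subring_gen_closed (A : nzRingType) (X : set A) :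
  subring_closed (subring_gen X).
Proof.
split=> [|x y /asboolP hx /asboolP hy|x y /asboolP hx /asboolP hy];
  apply/asboolP => S XS.
- exact: rpred1.
- by apply: rpredB; [apply: hx|apply: hy].
- by apply: rpredM; [apply: hx|apply: hy].
Qed.

HB.instance Definition _ (A : nzRingType) (X : set A) :=
  GRing.isSubringClosed.Build A (subring_gen X) (subring_gen_closed X).

Definition plusGR_pred (K : fieldType) (R : idomAlgType K)
  (G : standard_grading R) (L : closedFieldType)
  (iota : {rmorphism {fraction R} -> L}) : subringClosed L :=
  subring_gen [set f | exists d : rat, 0 <= d /\ GR_homogeneous G iota d f].

Fact frac_emb_plusGR (K : fieldType) (R : idomAlgType K)
  (G : standard_grading R) (L : closedFieldType)
  (iota : {rmorphism {fraction R} -> L}) r :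
  frac_emb iota r \in plusGR_pred G iota.
Proof.
have [_ dG _] := piece_direct G.
have [s [f [_ _ Gf ->]]] := dG r.
rewrite rmorph_sum; apply: rpred_sum => i _; apply/asboolP => S; apply.
rewrite inE; exists i%:R; split; first exact: Num.Theory.ler0n.
exists 1%N, (fun=> - f i); split.
  case=> [|[|j]] // _; right; exists i; rewrite mul1r; split=> //.
  by have [zG _ _] := piece_direct G; case: (zG i) => G0 /(_ _ _ G0 (Gf i));
    rewrite sub0r.
by rewrite big_nat1 subnn expr0 mulr1 expr1 rmorphN subrr.
Qed.

Definition plusGR_emb (K : fieldType) (R : idomAlgType K)
  (G : standard_grading R) (L : closedFieldType)
  (iota : {rmorphism {fraction R} -> L}) :
  {rmorphism R -> subring (plusGR_pred G iota)} :=
  corestr (frac_emb_plusGR G iota).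

(* Graded-plus closure computed in R^+GR; R^+gr, a direct summand of R^+GR,
   gives the same closure. *)
Definition graded_plus_closure (K : fieldType) (R : idomAlgType K)
  (G : standard_grading R) (L : closedFieldType)
  (iota : {rmorphism {fraction R} -> L}) (M : lmodType R)
  (N : submodClosed M) : set M := extension_closure (plusGR_emb G iota) N.

Arguments graded_plus_closure {K R} G {L} iota {M} N _.

Lemma pchar_algebra (K : fieldType) (R : comAlgType K) (p : nat)
  (pK : p \in [pchar K]) : p \in [pchar R].
Proof. by rewrite pchar_lalg. Qed.

Arguments pchar_algebra {K} R {p} pK.

(* Main.v *)
(* Write the larger closure of N in M as the set of u with 1 (x) u = 0 in
   T_e = S_e (x) M/N for some e, where S_e is R viewed as an R-module through F^e in
   (1), and S_e = R^+GR in (2).  Each S_e has projections pi_i onto its components of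
   integer degree i, and the components of high degree lie in (x_1^k, ..., x_n^k) S_e,
   for x_1, ..., x_n generators of degree 1, hence act as 0 on M/N.  So the R-linear
   map f sending m to the family of s |-> sum_i pi_i(s) (x) m, in the product of the
   Hom_Z(S_e, T_e), involves finitely many degrees, and the homogeneous components of
   the f(m), for m among generators of M, span a finitely generated graded module M'
   killed by a power of the irrelevant ideal.  If u is in N^* then f(u) is in the tight
   closure of 0 in M', hence by hypothesis in the larger closure of 0 in M', and
   evaluating at s = 1 yields 1 (x) u = 0 in T_e for some e. *)

Require Import Defs.
From HB Require Import structures.
From mathcomp Require Import all_boot all_order all_algebra.
From mathcomp Require Import generic_quotient ring_quotient fraction freeg.
From mathcomp Require Import zify boolp classical_sets.

Set Implicit Arguments.
Unset Strict Implicit.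
Unset Printing Implicit Defensive.

Import GRing.Theory Num.Theory.
(* Again, so that the local [span] and [semilinear_for] shadow those of mathcomp. *)
Import Defs.

Local Open Scope ring_scope.

(** * Tensor products as abelian groups *)

(** The product over e is forced by the order of the quantifiers: the exponent e that the hypothesis
    supplies for M' is known only after M' has been built. The product is harmless because the bound
    on the degrees does not depend on e: degree i in S_e is degree i q in R, and a form of degree
    above n k q lies in the ideal of the x_l^(k q), the images of the x_l^k under F^e. In R^+GR the
    same bound comes from reducing f^q, for large q, by the integral equation of f and then taking
    q-th roots, which stay in R^+GR.

    As r acts by (r g)(s) = g(r s), precomposition with pi_i projects onto degree -i.

    The opposite inclusions hold for all N in M: Frobenius closure lies in tight closure, and
    graded-plus closure in plus closure, which lies in tight closure. *)

Definition dprod (I : Type) (T : I -> zmodType) := forall i, T i.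

Section DProd.
Variables (I : Type) (T : I -> zmodType).

HB.instance Definition _ := gen_eqMixin (dprod T).
HB.instance Definition _ := gen_choiceMixin (dprod T).

Let zero : dprod T := fun=> 0.
Let opp (f : dprod T) : dprod T := fun i => - f i.
Let add (f g : dprod T) : dprod T := fun i => f i + g i.

Fact dprod_addA : associative add.
Proof. by move=> f g h; apply: functional_extensionality_dep => i; apply: addrA. Qed.
Fact dprod_addC : commutative add.
Proof. by move=> f g; apply: functional_extensionality_dep => i; apply: addrC. Qed.
Fact dprod_add0 : left_id zero add.
Proof. by move=> f; apply: functional_extensionality_dep => i; apply: add0r. Qed.
Fact dprod_addN : left_inverse zero opp add.
Proof. by move=> f; apply: functional_extensionality_dep => i; apply: addNr. Qed.

HB.instance Definition _ :=
  GRing.isZmodule.Build (dprod T) dprod_addA dprod_addC dprod_add0 dprod_addN.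

Lemma dprodE (f g : dprod T) i : (f - g) i = f i - g i. Proof. by []. Qed.
Lemma dprodDE (f g : dprod T) i : (f + g) i = f i + g i. Proof. by []. Qed.
Lemma dprod0E i : (0 : dprod T) i = 0. Proof. by []. Qed.

End DProd.

Section HomProduct.
Variables (I : Type) (S : I -> comNzRingType) (T : I -> zmodType).

Let V := dprod (fun i => dprod (fun _ : S i => T i)).

Definition homs_pred : {pred V} :=
  fun g => `[< forall i x y, g i (x - y) = g i x - g i y >].

Fact homs_zmod_closed : zmod_closed homs_pred.
Proof.
split=> [|g h /asboolP gB /asboolP hB]; apply/asboolP => i x y.
  by rewrite !dprod0E subrr.
by rewrite !dprodE gB hB !opprD !opprK addrACA.
Qed.

HB.instance Definition _ := GRing.isZmodClosed.Build V homs_pred homs_zmod_closed.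

Record homs := Coind { homs_val : V; _ : homs_val \in homs_pred }.

HB.instance Definition _ := [isSub for homs_val].
HB.instance Definition _ := [Choice of homs by <:].
HB.instance Definition _ := [SubChoice_isSubZmodule of homs by <:].

Definition capp (g : homs) i (s : S i) : T i := val g i s.

Lemma cappB g i x y : @capp g i (x - y) = capp g x - capp g y.
Proof. by have /asboolP := valP g; apply. Qed.

HB.instance Definition _ g i :=
  GRing.isZmodMorphism.Build (S i) (T i) (@capp g i) (@cappB g i).

Lemma homsP (g h : homs) : (forall i (s : S i), capp g s = capp h s) -> g = h.
Proof.
move=> gh; apply: val_inj; apply: functional_extensionality_dep => i.
by apply: functional_extensionality_dep => s; apply: gh.
Qed.

Fact homs_mk_subproof (f : forall i, S i -> T i) :
  (forall i, zmod_morphism (f i)) -> (f : V) \in homs_pred.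
Proof. by move=> fB; apply/asboolP => i x y; apply: fB. Qed.

Definition homs_mk (f : forall i, S i -> T i) (fB : forall i, zmod_morphism (f i)) :=
  Coind (homs_mk_subproof fB).

Lemma homs_mkE f fB i s : @capp (@homs_mk f fB) i s = f i s.
Proof. by []. Qed.

Lemma capp_addE g h i s : @capp (g + h) i s = capp g s + capp h s.
Proof. by []. Qed.

Lemma capp0E i s : @capp 0 i s = 0.
Proof. by []. Qed.

Lemma capp_sumE (J : Type) (r : seq J) (P : pred J) (F : J -> homs) i s :
  @capp (\sum_(j <- r | P j) F j) i s = \sum_(j <- r | P j) capp (F j) s.
Proof. by elim/big_rec2: _ => // j x y _ <-. Qed.

Definition precomp (u : forall i, S i -> S i)
  (uB : forall i, zmod_morphism (u i)) (g : homs) : homs :=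
  @homs_mk (fun i s => capp g (u i s)) (fun i x y =>
    etrans (congr1 (fun z => capp g z) (uB i x y)) (cappB g _ _)).

End HomProduct.

(* R acts on the product of the [Hom_Z (S i, T i)] by
   [(r g) (s) = g (phi i r * s)]; the morphisms [phi] are part of the type. *)
Section Coinduced.
Variables (R : comNzRingType) (I : Type) (S : I -> comNzRingType).
Variables (phi : forall i, {rmorphism R -> S i}) (T : I -> zmodType).

Definition coind (_ : forall i, {rmorphism R -> S i}) := homs S T.

HB.instance Definition _ := GRing.Zmodule.on (coind phi).

Fact coind_mul_zmod (r : R) i : zmod_morphism (fun s : S i => phi i r * s).
Proof. by move=> x y; rewrite mulrBr. Qed.

Definition coind_scale (r : R) : coind phi -> coind phi := precomp (coind_mul_zmod r).

Lemma coind_scaleE r (g : coind phi) i (s : S i) :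
  capp (coind_scale r g) s = capp g (phi i r * s).
Proof. by []. Qed.

Fact coind_scaleA a b g : coind_scale a (coind_scale b g) = coind_scale (a * b) g.
Proof. by apply: homsP => i s; rewrite !coind_scaleE mulrA -rmorphM (mulrC b). Qed.
Fact coind_scale1 : left_id 1 coind_scale.
Proof. by move=> g; apply: homsP => i s; rewrite !coind_scaleE rmorph1 mul1r. Qed.
Fact coind_scaleDr : right_distributive coind_scale +%R.
Proof. by move=> a g h; apply: homsP. Qed.
Fact coind_scaleDl g : {morph coind_scale^~ g : a b / a + b}.
Proof.
move=> a b; apply: homsP => i s; rewrite capp_addE !coind_scaleE rmorphD mulrDl.
exact: (raddfD (@capp _ _ _ g i)).
Qed.

HB.instance Definition _ := GRing.Zmodule_isLmodule.Build R (coind phi)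
  coind_scaleA coind_scale1 coind_scaleDr coind_scaleDl.

Lemma capp_scaleE r (g : coind phi) i (s : S i) :
  capp (r *: g) s = capp g (phi i r * s).
Proof. by []. Qed.

End Coinduced.

Record balanced (R S : comNzRingType) (phi : {rmorphism R -> S})
  (M : lmodType R) (T : zmodType) (b : S -> M -> T) : Prop := Balanced {
  balancedBl : forall m, zmod_morphism (b^~ m);
  balancedDr : forall s x y, b s (x + y) = b s x + b s y;
  balancedZ : forall r s m, b (phi r * s) m = b s (r *: m)
}.

Section TensorQuotient.
Variables (R S : comNzRingType) (phi : {rmorphism R -> S}).

(* The universal property of the tensor product for maps to a mere abelian group T,
   through the coinduced S-module Hom_Z(S, T). *)
Lemma balanced_vanish (M : lmodType R) (N : submodClosed M) (T : zmodType)
    (b : S -> M -> T) (s0 : S) (u : M) :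
  balanced phi b -> (forall s n, n \in N -> b s n = 0) ->
  tensor_image phi N (tens phi s0 u) -> b s0 u = 0.
Proof.
move=> [bB bD bZ] bN.
pose Q : lmodType S := coind (fun=> T) (fun _ : unit => (idfun : {rmorphism S -> S})).
pose g m : Q := homs_mk (fun _ : unit => bB m).
have gl : semilinear_for phi g.
  split=> [m n|r m]; apply: homsP => i s.
    by rewrite capp_addE !homs_mkE bD.
  by rewrite capp_scaleE !homs_mkE /= bZ.
have gN n : g (incl N n) = 0.
  by apply: homsP => i s; rewrite homs_mkE capp0E bN // /incl /= (valP n).
have gNl : semilinear_for phi (fun n => g (incl N n)).
  by split=> [m n|r m]; rewrite !gN ?addr0 ?scaler0.
have [hD hZ] := gl.
pose h : tensor phi M -> Q := tensor_lift g.
pose k : tensor phi (submod N) -> tensor phi M := tensor_map (incl N).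
have kl : linear k.
  apply: tensor_lift_linear; have [tD tZ] := tens_semilinear phi M.
  by split=> [x y|r x]; rewrite ?raddfD ?linearZ /= ?tD ?tZ.
have hl : linear h by exact: tensor_lift_linear.
pose ha := GRing.isLinear.Build _ _ _ _ h hl.
pose hL : {linear tensor phi M -> Q} := HB.pack h ha.
pose ka := GRing.isLinear.Build _ _ _ _ k kl.
pose kL : {linear tensor phi (submod N) -> tensor phi M} := HB.pack k ka.
have hk t : h (k t) = 0.
  pose hkL : {linear tensor phi (submod N) -> Q} := hL \o kL.
  pose z : {linear tensor phi (submod N) -> Q} := \0.
  apply: (@tensor_lift_uniq _ _ phi _ _ hkL z) => m /=.
  by rewrite /k tensor_mapE /h tensor_liftE // gN scaler0.
case=> t _ tu; have := hk t; rewrite /k tu /h tensor_liftE //.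
move=> /(congr1 (fun q : Q => @capp _ _ _ q tt 1)).
by rewrite capp_scaleE homs_mkE /= mulr1.
Qed.

Variables (M : lmodType R) (N : submodClosed M).

(** By right exactness this is S (x) M/N. As a quotient of S (x) M it turns membership in the image
    of S (x) N into the vanishing of [tcls]. *)
Definition tquot : lmodType S :=
  modquot (span (tensor_image phi N)).

Definition tcls (s : S) (m : M) : tquot :=
  modquot_pi (span (tensor_image phi N)) (tens phi s m).

Lemma tclsE s m : tcls s m = s *: tcls 1 m.
Proof. by rewrite /tcls -linearZ tens_scale. Qed.

Lemma tcls_balanced : balanced phi tcls.
Proof.
have [tD tZ] := tens_semilinear phi M.
split=> [m x y|s x y|r s m].
- by rewrite (tclsE (x - y)) (tclsE x) (tclsE y) scalerBl.
- by rewrite (tclsE s (x + y)) (tclsE s x) (tclsE s y) /tcls tD raddfD scalerDr.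
- rewrite (tclsE _ m) (tclsE s (r *: m)) mulrC -scalerA; congr (_ *: _).
  by rewrite /tcls tZ linearZ.
Qed.

Lemma tcls_vanish s n : n \in N -> tcls s n = 0.
Proof.
move=> nN; rewrite /tcls -[RHS](raddf0 (modquot_pi (span (tensor_image phi N)))).
apply/modquot_eqP; rewrite subr0; apply: mem_span.
by exists (tens phi s (Submod nN)) => //; rewrite tensor_mapE.
Qed.

Lemma tensor_image_closed : submod_closed (fun t => `[< tensor_image phi N t >]).
Proof.
have [tD tZ] := tens_semilinear phi M.
have kl : linear (tensor_map (incl N) : tensor phi (submod N) -> tensor phi M).
  apply: tensor_lift_linear.
  by split=> [x y|r x]; rewrite ?raddfD ?linearZ /= ?tD ?tZ.
split=> [|a x y /asboolP[t _ <-] /asboolP[t' _ <-]]; apply/asboolP.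
  exists 0 => //; have := kl (-1) 0 0.
  by rewrite scaleN1r oppr0 addr0 scaleN1r addNr.
by exists (a *: t + t') => //; rewrite kl.
Qed.

Lemma modquot_pi_tensor_image t :
  modquot_pi (span (tensor_image phi N)) t = 0 <-> tensor_image phi N t.
Proof.
split=> [t0|tN]; last first.
  rewrite -[RHS](raddf0 (modquot_pi (span (tensor_image phi N)))).
  by apply/modquot_eqP; rewrite subr0; apply: mem_span.
have : t - 0 \in span (tensor_image phi N).
  by apply/modquot_eqP; rewrite t0 raddf0.
rewrite subr0 => /asboolP.
pose B := GRing.isSubmodClosed.Build _ _ (fun t => `[< tensor_image phi N t >])
  tensor_image_closed.
pose W : submodClosed (tensor phi M) :=
  HB.pack (fun t => `[< tensor_image phi N t >]) B.
move=> /(_ W) h; have tW : t \in W.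
  by apply: h => y yN; apply/asboolP; move: yN; rewrite inE.
exact/asboolP.
Qed.

Lemma tcls_eq0 s u : tcls s u = 0 <-> tensor_image phi N (tens phi s u).
Proof. exact: modquot_pi_tensor_image. Qed.

End TensorQuotient.

(** The map (s, m) |-> psi(s) (x) m is balanced. This serves both for a further power of Frobenius
    and for the inclusion of R^+GR in R^+. *)
Lemma extension_closure_comp (R S S' : comNzRingType) (phi : {rmorphism R -> S})
  (phi' : {rmorphism R -> S'}) (psi : {rmorphism S -> S'}) (M : lmodType R)
  (N : submodClosed M) (u : M) :
  (forall r, psi (phi r) = phi' r) ->
  extension_closure phi N u -> extension_closure phi' N u.
Proof.
move=> pp uN; apply/tcls_eq0; rewrite -(rmorph1 psi).
have [bB bD bZ] := tcls_balanced phi' N.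
apply: (@balanced_vanish R S phi M N _ (fun s m => tcls phi' N (psi s) m)) uN.
- split=> [m x y|s x y|r s m] //=; first by rewrite raddfB bB.
  by rewrite rmorphM pp bZ.
- by move=> s n nN; apply: tcls_vanish.
Qed.

Lemma tensor_image_linear (R S : comNzRingType) (phi : {rmorphism R -> S})
  (M M' : lmodType R) (f : {linear M -> M'}) (N : submodClosed M)
  (N' : submodClosed M') (s : S) (u : M) :
  (forall n, n \in N -> f n \in N') ->
  tensor_image phi N (tens phi s u) -> tensor_image phi N' (tens phi s (f u)).
Proof.
move=> fN uN; apply/tcls_eq0; have [bB bD bZ] := tcls_balanced phi N'.
apply: (@balanced_vanish R S phi M N _ (fun s m => tcls phi N' s (f m))) uN.
- split=> [m x y|s' x y|r s' m] /=; first exact: bB.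
    by rewrite raddfD bD.
  by rewrite linearZ bZ.
- by move=> s' n nN; apply/tcls_vanish/fN.
Qed.

(** * Standard graded algebras *)

Section StandardGraded.
Variables (K : fieldType) (R : comAlgType K) (G : standard_grading R).

Lemma piece_zmod i : zmod_closed (G i).
Proof. by have [zG _ _] := piece_direct G. Qed.

HB.instance Definition _ i := GRing.isZmodClosed.Build R (G i) (piece_zmod i).

Lemma piece1 : 1 \in G 0%N.
Proof. by apply/piece0P; exists 1; rewrite scale1r. Qed.

Lemma pieceX i x n : x \in G i -> x ^+ n \in G (i * n)%N.
Proof.
move=> xG; elim: n => [|n IH]; first by rewrite expr0 muln0 piece1.
by rewrite exprS mulnS; apply: piece_mul.
Qed.

Lemma graded_poly_inj (f g : {poly R}) :
  (forall i, f`_i \in G i) -> (forall i, g`_i \in G i) -> f.[1] = g.[1] -> f = g.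
Proof.
move=> fG gG fg; have [_ _ G0] := piece_direct G.
apply/eqP; rewrite -subr_eq0; apply/eqP/polyP => i; rewrite coef0.
have [iS|iS] := ltnP i (size (f - g)); last by rewrite nth_default.
apply: (G0 (iota 0 (size (f - g))) (fun i => (f - g)`_i)).
- exact: iota_uniq.
- by move=> j; rewrite coefB rpredB.
- have : (f - g).[1] = 0 by rewrite hornerD hornerN fg subrr.
  rewrite horner_coef -(big_mkord predT (fun i => (f - g)`_i * 1 ^+ i)).
  rewrite /index_iota subn0 => h; rewrite -[RHS]h.
  by apply: eq_bigr => j _; rewrite expr1n mulr1.
- by rewrite mem_iota.
Qed.

Lemma graded_poly_exists (r : R) :
  exists f : {poly R}, (forall i, f`_i \in G i) /\ f.[1] = r.
Proof.
have [_ dG _] := piece_direct G.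
have [s [f [_ _ fG ->]]] := dG r.
exists (\sum_(i <- s) f i *: 'X^i); split=> [i|].
  rewrite coef_sum; apply: rpred_sum => j _; rewrite coefZ coefXn.
  by case: eqP => [->|_]; rewrite ?mulr1 ?mulr0 ?rpred0.
rewrite horner_sum; apply: eq_bigr => i _.
by rewrite hornerZ hornerXn expr1n mulr1.
Qed.

(* [hpoly r] is the sum of the [r_i 'X^i], for [r_i] the component of [r] of degree i. *)
Definition hpoly (r : R) : {poly R} := sval (cid (graded_poly_exists r)).

Lemma hpoly_piece r i : (hpoly r)`_i \in G i.
Proof. by rewrite /hpoly; case: cid => f [] /=. Qed.

Lemma hpoly1E r : (hpoly r).[1] = r.
Proof. by rewrite /hpoly; case: cid => f [] /=. Qed.

Lemma hpolyP r (f : {poly R}) : (forall i, f`_i \in G i) -> f.[1] = r -> hpoly r = f.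
Proof.
by move=> fG fr; apply: graded_poly_inj; rewrite ?hpoly1E //; apply: hpoly_piece.
Qed.

Fact hpoly_zmod : zmod_morphism hpoly.
Proof.
move=> x y; apply: hpolyP => [i|]; last by rewrite hornerD hornerN !hpoly1E.
by rewrite coefB rpredB ?hpoly_piece.
Qed.

(** A grading by the natural numbers amounts to a coaction R -> R[X]. Having it as a ring morphism
    makes integral dependence over its image available later. *)
Fact hpoly_monoid : monoid_morphism hpoly.
Proof.
split=> [|x y].
  apply: hpolyP => [i|]; last by rewrite hornerC.
  by rewrite coef1; case: i => [|i]; rewrite ?piece1 ?rpred0.
apply: hpolyP => [i|]; last by rewrite hornerM !hpoly1E.
rewrite coefM; apply: rpred_sum => j _.
have := piece_mul (hpoly_piece x j) (hpoly_piece y (i - j)).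
by rewrite subnKC // -ltnS.
Qed.

HB.instance Definition _ := GRing.isZmodMorphism.Build R {poly R} hpoly hpoly_zmod.
HB.instance Definition _ := GRing.isMonoidMorphism.Build R {poly R} hpoly hpoly_monoid.

Lemma hpoly_homog d r : r \in G d -> hpoly r = r *: 'X^d.
Proof.
move=> rG; apply: hpolyP => [i|]; last by rewrite hornerZ hornerXn expr1n mulr1.
by rewrite coefZ coefXn; case: eqP => [->|_]; rewrite ?mulr1 ?mulr0 ?rpred0.
Qed.

Lemma hpolyM_homog d r s i :
  r \in G d -> (hpoly (r * s))`_(i + d) = r * (hpoly s)`_i.
Proof.
by move=> /hpoly_homog rX; rewrite rmorphM /= rX -scalerAl coefZ coefXnM ltnNge leq_addl addnK.
Qed.

Lemma hpolyM_homog_lt d r s i :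
  r \in G d -> (i < d)%N -> (hpoly (r * s))`_i = 0.
Proof.
by move=> /hpoly_homog rX id; rewrite rmorphM /= rX -scalerAl coefZ coefXnM id mulr0.
Qed.

Lemma hpoly_sum r : r = \sum_(i < size (hpoly r)) (hpoly r)`_i.
Proof.
rewrite -[LHS]hpoly1E horner_coef; apply: eq_bigr => i _.
by rewrite expr1n mulr1.
Qed.

Lemma homog_ind (P : R -> Prop) :
  P 0 -> (forall x y, P x -> P y -> P (x + y)) ->
  (forall d x, x \in G d -> P x) -> forall x, P x.
Proof.
move=> P0 PD PG x; rewrite [x]hpoly_sum; elim/big_ind: _ => // i _.
exact: PG (hpoly_piece x i).
Qed.

(** The values at [xs] of homogeneous polynomials of degree D over K, with one linear factor split
    off at each step, as the pigeonhole argument consumes them. *)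
Fixpoint form_in (xs : seq R) (D : nat) (r : R) : Prop :=
  if D is D'.+1 then
    exists a : 'I_(size xs) -> R,
      (forall l, form_in xs D' (a l)) /\ r = \sum_(l < size xs) xs`_l * a l
  else r \in G 0%N.

Lemma form_in0 xs D : form_in xs D 0.
Proof.
elim: D => [|D IH] /=; first exact: rpred0.
by exists (fun=> 0); split=> //; rewrite big1 // => i _; rewrite mulr0.
Qed.

Lemma form_inD xs D x y : form_in xs D x -> form_in xs D y -> form_in xs D (x + y).
Proof.
elim: D x y => [|D IH] x y /=; first exact: rpredD.
move=> [a [aF ->]] [b [bF ->]]; exists (fun l => a l + b l); split=> [l|].
  exact: IH.
by rewrite -big_split; apply: eq_bigr => l _; rewrite mulrDr.
Qed.

Lemma form_inM0 xs D x y : x \in G 0%N -> form_in xs D y -> form_in xs D (x * y).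
Proof.
move=> x0; elim: D y => [|D IH] y /=; first by move=> y0; apply: (piece_mul (i := 0%N)).
move=> [a [aF ->]]; exists (fun l => x * a l); split=> [l|]; first exact: IH.
by rewrite mulr_sumr; apply: eq_bigr => l _; rewrite mulrCA.
Qed.

Lemma form_inM xs D E x y :
  form_in xs D x -> form_in xs E y -> form_in xs (D + E) (x * y).
Proof.
move=> xF yF; elim: D x xF => [|D IH] x /=; first by move=> x0; apply: form_inM0.
move=> [a [aF ->]]; exists (fun l => a l * y); split=> [l|]; first exact: IH.
by rewrite mulr_suml; apply: eq_bigr => l _; rewrite mulrA.
Qed.

(** The elements whose component in each degree D is a form of degree D in the generators make up a
    subalgebra containing the generators, hence everything. *)
Lemma piece_form_in : exists xs : seq R, {subset xs <= G 1%N} /\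
  forall D x, x \in G D -> form_in xs D x.
Proof.
have [xs [xsG xs_gen]] := piece1_gen G; exists xs; split=> // D x xG.
pose A : {pred R} := fun r => `[< forall D, form_in xs D (hpoly r)`_D >].
have form1 i y : y \in G i -> form_in xs i y -> forall j, form_in xs j (hpoly y)`_j.
  move=> yG yF j; rewrite (hpoly_homog yG) coefZ coefXn.
  by case: eqP => [->|_]; rewrite ?mulr1 ?mulr0 //; apply: form_in0.
have A_alg : subalg_closed A.
  split=> [|a u v /asboolP uA /asboolP vA|u v /asboolP uA /asboolP vA];
    apply/asboolP => E.
  - by apply: (form1 0%N); rewrite //= piece1.
  - rewrite raddfD coefD; apply: form_inD => //.
    have -> : a *: u = a%:A * u by rewrite -scalerAl mul1r.
    have aG : a%:A \in G 0%N by apply/piece0P; exists a.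
    by rewrite -[E]addn0 (hpolyM_homog _ _ aG) addn0; apply: form_inM0.
  - rewrite rmorphM coefM; elim/big_ind: _ => [|s t|i _]; first exact: form_in0.
      exact: form_inD.
    by rewrite -[X in form_in _ X](subnKC (ltnSE (ltn_ord i))); apply: form_inM.
pose B := GRing.isSubalgClosed.Build K R A A_alg.
pose AS : subalgClosed R := HB.pack A B.
have /asboolP/(_ D) : x \in AS.
  apply: xs_gen => y yxs; apply/asboolP; apply: (form1 1%N); first exact: xsG.
  exists (fun l => (l == index y xs :> nat)%:R); split=> [l|].
    by rewrite /=; case: eqP; rewrite ?rpred0 ?piece1.
  have yl : (index y xs < size xs)%N by rewrite index_mem.
  rewrite (bigD1 (Ordinal yl)) //= eqxx mulr1 nth_index // big1 ?addr0 //.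
  by move=> i; rewrite -val_eqE /= => /negPf ->; rewrite mulr0.
by rewrite (hpoly_homog xG) coefZ coefXn eqxx mulr1.
Qed.

(* Pigeonhole: in a monomial of degree D some exponent exceeds k.  The induction is on D,
   with the exponents already collected kept in the factor [prod_l xs_l^(k - b_l)]. *)
Lemma form_in_powers xs (k D : nat) (r : R) :
  (size xs * k < D)%N -> form_in xs D r ->
  exists a : 'I_(size xs) -> R, r = \sum_(l < size xs) xs`_l ^+ k * a l.
Proof.
pose J r := exists a : 'I_(size xs) -> R, r = \sum_(l < size xs) xs`_l ^+ k * a l.
have J0 : J 0 by exists (fun=> 0); rewrite big1 // => i _; rewrite mulr0.
have JD x y : J x -> J y -> J (x + y).
  move=> [a ->] [b ->]; exists (fun l => a l + b l).
  by rewrite -big_split; apply: eq_bigr => l _; rewrite mulrDr.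
have JX l y : J (xs`_(l : 'I_(size xs)) ^+ k * y).
  exists (fun j => (j == l)%:R * y); rewrite (bigD1 l) //= eqxx mul1r big1 ?addr0 //.
  by move=> i /negPf ->; rewrite mul0r mulr0.
suff H : forall D (b : 'I_(size xs) -> nat) r, (forall l, b l <= k)%N ->
    (\sum_(l < size xs) b l < D)%N -> form_in xs D r -> J (r * \prod_(l < size xs) xs`_l ^+ (k - b l)).
  move=> kD rF; have := H D (fun=> k) r; rewrite sum_nat_const card_ord.
  rewrite big1 ?mulr1; first exact.
  by move=> l _; rewrite subnn.
elim=> [//|{}D IH] b {}r bk; rewrite ltnS => bD [a [aF ->]].
rewrite mulr_suml; elim/big_ind: _ => // l _.
have [bl0|bl0] := posnP (b l).
  by rewrite (bigD1 l) //= bl0 subn0 mulrCA; apply: JX.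
pose b' j := if j == l then (b l).-1 else b j.
have b'E : b' l = (b l).-1 by rewrite /b' eqxx.
have b'l i : i != l -> b' i = b i by move=> /negPf il; rewrite /b' il.
have -> : xs`_l * a l * \prod_(j < size xs) xs`_j ^+ (k - b (j : 'I_(size xs)))
    = a l * \prod_(j < size xs) xs`_j ^+ (k - b' (j : 'I_(size xs))).
  rewrite (bigD1 l) //= [in RHS](bigD1 l) //= b'E.
  rewrite [in RHS](eq_bigr (fun j : 'I_(size xs) => xs`_j ^+ (k - b j))) => [|i il]; last by rewrite b'l.
  have -> : (k - (b l).-1)%N = (k - b l).+1 by rewrite -subnSK prednK.
  rewrite exprS -!mulrA. exact: mulrCA.
apply: IH => [j||]; last exact: aF.
  by rewrite /b'; case: eqP => _ //; apply: leq_trans (leq_pred _) (bk l).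
apply: leq_trans bD; rewrite (bigD1 l) //= [in X in (_ <= X)%N](bigD1 l) //= b'E.
rewrite -addSn prednK // leq_add2l leq_eqVlt; apply/orP; left; apply/eqP.
by apply: eq_bigr => i; apply: b'l.
Qed.

End StandardGraded.

(** * Graded envelopes *)

Lemma span_ind (R : nzRingType) (M : lmodType R) (X : set M) (P : M -> Prop) :
  P 0 -> (forall a x y, P x -> P y -> P (a *: x + y)) -> (forall x, X x -> P x) ->
  forall x, x \in span X -> P x.
Proof.
move=> P0 PD PX x /asboolP xX.
have Pc : submod_closed (fun x => `[< P x >]).
  split=> [|a y z /asboolP Py /asboolP Pz]; apply/asboolP => //; exact: PD.
pose B := GRing.isSubmodClosed.Build R M (fun x => `[< P x >]) Pc.
pose W : submodClosed M := HB.pack (fun x => `[< P x >]) B.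
have xW : x \in W by apply: xX => y yX; apply/asboolP/PX; rewrite inE in yX.
exact/asboolP.
Qed.

Lemma fin_gen_span (R : nzRingType) (M : lmodType R) (s : seq M) :
  fin_gen (submod (span [set x | x \in s])).
Proof.
pose W := span [set x | x \in s].
have sW x : x \in s -> x \in W by move=> xs; apply: mem_span.
pose s' : seq (submod W) := pmap insub s.
have ss' : [seq val x | x <- s'] = s.
  rewrite pmap_filter; last exact: insubK.
  by apply/all_filterP/allP => x /sW xW; rewrite insubT.
exists s' => x; pose P y := exists c : 'I_(size s') -> R, y = \sum_(i < size s') c i *: val (s'`_i).
have [||y ys|c xE] := @span_ind R M [set x | x \in s] P _ _ _ (val x) (valP x).
- by exists (fun=> 0); rewrite big1 // => i _; rewrite scale0r.
- move=> a y z [c ->] [d ->]; exists (fun i => a * c i + d i).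
  rewrite scaler_sumr -big_split; apply: eq_bigr => i _.
  by rewrite scalerDl scalerA.
- have ys' : (index y s < size s')%N by rewrite -(size_map val) ss' index_mem.
  exists (fun i => (i == Ordinal ys')%:R); rewrite (bigD1 (Ordinal ys')) //=.
  rewrite eqxx scale1r big1 ?addr0 => [|i /negPf ->]; last by rewrite scale0r.
  by rewrite -[RHS](nth_map 0 0 val ys') ss' nth_index.
exists c; apply: val_inj; rewrite xE -[RHS]/(incl W _) raddf_sum.
exact: eq_bigr.
Qed.

Section GradedEnvelope.
Variables (K : fieldType) (R : comAlgType K) (G : standard_grading R).
Variables (E : lmodType R) (c : nat -> {additive E -> E}).

(* The operators [c i] project onto the components of degree [-i] of a graded
   module contained in [E]. *)
Hypothesis cc : forall i j x, c i (c j x) = if i == j then c j x else 0.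
Hypothesis cZ : forall d i r x, r \in G d -> c i (r *: x) = r *: c (i + d) x.
Hypothesis cZ0 : forall d i r x, r \in G d -> (i < d)%N -> r *: c i x = 0.

Let supp n x := x = \sum_(0 <= i < n) c i x.

Let supp_c n x i : supp n x -> (n <= i)%N -> c i x = 0.
Proof.
move=> -> ni; rewrite raddf_sum big_nat big1 // => j /andP[_ jn].
by rewrite cc gtn_eqF // (leq_trans jn).
Qed.

Let suppW n m x : (n <= m)%N -> supp n x -> supp m x.
Proof.
move=> nm xn; rewrite /supp (big_cat_nat (leq0n n) nm) /= -xn.
rewrite big_nat big1 ?addr0 // => i /andP[ni _]; exact: supp_c xn ni.
Qed.

Let supp0 n : supp n 0.
Proof. by rewrite /supp big1 // => i _; rewrite raddf0. Qed.

Let suppD n x y : supp n x -> supp n y -> supp n (x + y).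
Proof.
move=> xn yn; rewrite /supp {1}xn {1}yn -big_split.
by apply: eq_bigr => i _; rewrite raddfD.
Qed.

Let suppZ_homog n d r x : r \in G d -> supp n x -> supp (n - d) (r *: x).
Proof.
move=> rG xn; rewrite /supp; have [nd|dn] := leqP n d.
  have -> : (n - d = 0)%N by apply/eqP; rewrite subn_eq0.
  rewrite big_geq // xn scaler_sumr big_nat big1 // => i /andP[_ iN].
  by apply: cZ0 rG _; apply: leq_trans nd.
rewrite {1}xn scaler_sumr (big_cat_nat (n := d)) //=; last exact: ltnW.
rewrite big_nat big1 ?add0r => [|i /andP[_ id]]; last exact: cZ0 rG id.
rewrite -{1}[d]add0n big_addn; apply: eq_bigr => i _.
by rewrite (cZ _ _ rG).
Qed.

Let suppZ n r x : supp n x -> supp n (r *: x).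
Proof.
move=> xn; elim/(@homog_ind _ _ G): r => [|r s rn sn|d r rG].
- by rewrite scale0r; apply: supp0.
- by rewrite scalerDl; apply: suppD.
- by apply: (suppW (leq_subr d n)); apply: suppZ_homog.
Qed.

Let supp_irrelevant n a x :
  irrelevant_ideal G a -> supp n.+1 x -> supp n (a *: x).
Proof.
move=> [s [g [_ s0 gG ->]]] xn; rewrite scaler_suml.
elim: s s0 => [|i s IH] /=; first by rewrite big_nil => _; apply: supp0.
move=> /andP[i0 /IH sn]; rewrite big_cons; apply: suppD sn.
by apply: suppW (suppZ_homog (gG i) xn); rewrite leq_subLR -add1n leq_add2r.
Qed.

Let supp_prod n (a : 'I_n -> R) x :
  (forall j, irrelevant_ideal G (a j)) -> supp n x -> (\prod_j a j) *: x = 0.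
Proof.
elim: n a x => [|n IH] a x aI xn.
  by rewrite xn big_geq // scaler0.
rewrite big_ord_recl mulrC -scalerA; apply: IH => //; exact: supp_irrelevant.
Qed.

(** The index being minus the degree, a form of degree d lowers the index by d and kills the indices
    below d. So a product of B elements of the irrelevant ideal kills whatever is supported on the
    indices below B. *)
Lemma graded_envelope (M : lmodType R) (f : {linear M -> E}) (B : nat) :
  fin_gen M -> (forall m, f m = \sum_(0 <= i < B) c i (f m)) ->
  exists (M' : lmodType R) (gM : int -> {pred M'}) (f' : {linear M -> M'})
    (h : {linear M' -> E}),
  [/\ graded_module G gM, fin_gen M', coprimary (irrelevant_ideal G) M',
      injective h & forall m, h (f' m) = f m].
Proof.
move=> [s s_gen] fB.
pose gens := [seq c i (f m) | i <- iota 0 B, m <- s].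
pose W := span [set x | x \in gens].
have fgens i m : m \in s -> c i (f m) \in W.
  move=> ms; have [iB|Bi] := ltnP i B; last by rewrite (supp_c (fB m)) ?rpred0.
  by apply: mem_span; apply/allpairsP; exists (i, m); rewrite mem_iota.
have WP : forall x, x \in W -> (forall i, c i x \in W) /\ supp B x.
  apply: span_ind => [|a x y [xW xB] [yW yB]|x].
  - by split=> [i|]; [rewrite raddf0 rpred0 | exact: supp0].
  - split=> [i|]; last by apply: suppD => //; exact: suppZ.
    rewrite raddfD rpredD //; elim/(@homog_ind _ _ G): a => [|a b aW bW|d a aG].
    + by rewrite scale0r raddf0 rpred0.
    + by rewrite scalerDl raddfD rpredD.
    + by rewrite (cZ _ _ aG) rpredZ.
  - move=> /allpairsP[[i m] /= [iB ms ->]]; split=> [j|].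
      by rewrite cc; case: eqP => _; rewrite ?fgens ?rpred0.
    rewrite mem_iota /= in iB; rewrite /supp /index_iota subn0.
    rewrite (bigD1_seq i) ?mem_iota ?iota_uniq //=.
    rewrite cc eqxx big1 ?addr0 // => j /negPf ji.
    by rewrite cc ji.
have fW m : f m \in W.
  have [a ->] := s_gen m; rewrite linear_sum; apply: rpred_sum => i _.
  rewrite linearZ rpredZ // fB; apply: rpred_sum => j _.
  by apply: fgens; apply: mem_nth.
pose M' : lmodType R := submod W.
(* Degree z consists of the elements fixed by the projector of index -z; a positive z leaves only
   0. *)
pose gM (z : int) : {pred M'} :=
  fun x => `[< val x = if (z <= 0)%R then c `|z|%N (val x) else 0 >].
pose f' m : M' := Submod (fW m).
have f'l : linear f' by move=> a x y; apply: val_inj; rewrite /= linearP.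
pose f'a := GRing.isLinear.Build _ _ _ _ f' f'l.
exists M', gM, (HB.pack f' f'a : {linear M -> M'}), (incl W); split=> //; last exact: val_inj; last first.
- exists B => r z [n [a [b [bI ->]]]]; apply: val_inj.
  rewrite -[LHS]/(_ *: val z) -[RHS]/(0 : E) scaler_suml big1 // => i _; rewrite -scalerA supp_prod ?scaler0 //.
  by have [] := WP _ (valP z).
- exact: fin_gen_span.
split; last first.
  move=> d j r x rG /asboolP xj; apply/asboolP.
  rewrite -[val (r *: x)]/(r *: val x).
  case: ifP xj => [j0 xj|_ ->]; last by rewrite scaler0 raddf0 if_same.
  have [dj|dj] := ifP.
    rewrite (cZ _ _ rG); have -> : (absz (d%:Z + j)%R + d = absz j)%N by lia.
    by rewrite -xj.
  by rewrite xj; apply: cZ0 rG _; lia.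
split.
- move=> z; split=> [|x y /asboolP xz /asboolP yz]; apply/asboolP.
    by rewrite !raddf0 if_same.
  rewrite -[val (x - y)]/(val x - val y) {1}xz {1}yz.
  case: ifP => _; rewrite ?subr0 //.
  by rewrite raddfB.
- move=> x; have [xW xB] := WP _ (valP x).
  exists [seq - i%:Z | i <- iota 0 B], (fun z => if (z <= 0)%R then Submod (xW `|z|%N) else 0).
  split.
  + by rewrite map_inj_uniq ?iota_uniq // => i j /oppr_inj[].
  + by apply/allP.
  + move=> i; apply/asboolP; case: ifP => //= _; by rewrite cc eqxx.
  + apply: val_inj; rewrite big_map raddf_sum [LHS]xB /index_iota subn0.
    apply: eq_bigr => i _; have -> : (- i%:Z <= 0)%R by lia.
    by rewrite abszN.
- move=> t g t_uniq gG g0 z zt; apply: val_inj; rewrite raddf0.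
  have /asboolP := gG z; case: ifP => [z0 gz|_ ->] //.
  have := congr1 (fun x => c `|z|%N (val x)) g0; rewrite !raddf0 !raddf_sum.
  rewrite (bigD1_seq z) //= -gz big1 ?addr0 // => y yz.
  have /asboolP := gG y; case: ifP => [y0 ->|_ ->]; last by rewrite raddf0.
  by rewrite cc; case: eqP => // zy; case/eqP: yz; lia.
Qed.

End GradedEnvelope.

Definition zero_submod (R : nzRingType) (M : lmodType R) : submodClosed M :=
  span (set0 : set M).

Lemma zero_submodP (R : nzRingType) (M : lmodType R) (x : M) :
  x \in zero_submod M -> x = 0.
Proof.
by apply: (span_ind (P := fun x => x = 0)) => // a y z -> ->; rewrite scaler0 addr0.
Qed.

Lemma fin_gen_zero_submod (R : nzRingType) (M : lmodType R) :
  fin_gen (submod (zero_submod M)).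
Proof.
exists [::] => x; exists (fun=> 0); rewrite big_ord0; apply: val_inj.
exact: zero_submodP (valP x).
Qed.

Lemma graded_zero_submod (R : nzRingType) (M : lmodType R) (gM : int -> {pred M}) :
  (forall i, zmod_closed (gM i)) -> graded_submod gM (zero_submod M).
Proof.
move=> gz x /zero_submodP ->; exists [::], (fun=> 0); split=> //; last by rewrite big_nil.
by move=> i; rewrite inE /= rpred0 andbT; case: (gz i).
Qed.

Lemma coprimary_zero_submod (R : comNzRingType) (J : set R) (M : lmodType R) :
  coprimary J M -> coprimary J (modquot (zero_submod M)).
Proof.
move=> [k kM]; exists k => r z rJ.
by rewrite -[z]modquot_pi_surj -linearZ /= kM // raddf0.
Qed.

(** * Passage from M to a graded module killed by a power of the irrelevant ideal *)

Section Key.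
Variables (K : fieldType) (R : comAlgType K) (G : standard_grading R).
Variables (I : Type) (S : I -> comNzRingType) (phi : forall i, {rmorphism R -> S i}).
(** The projections need not sum to the identity: components of fractional degree are dropped. Only
    the value at s = 1 has to be recovered, which [pr1] guarantees. *)
Variable pr : forall i, nat -> {additive S i -> S i}.
Hypothesis pr_pr : forall i a b s, pr i a (pr i b s) = if a == b then pr i b s else 0.
Hypothesis prZ : forall i a d r s, r \in G d ->
  pr i (a + d) (phi i r * s) = phi i r * pr i a s.
Hypothesis prZ0 : forall i a d r s, r \in G d -> (a < d)%N ->
  pr i a (phi i r * s) = 0.
Hypothesis pr1 : forall i, pr i 0%N 1 = 1.

Variables (M : lmodType R) (N : submodClosed M) (B : nat).
Hypothesis B_gt0 : (0 < B)%N.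
Hypothesis pr_vanish : forall i a s m, (B <= a)%N -> tcls (phi i) N (pr i a s) m = 0.

(** The last clause holds because (s, g) |-> g(s) is balanced and so induces a map from S_i (x) M'
    to T_i. It sends 1 (x) f(u) to the sum of the classes of pi_a(1) (x) u, which is that of 1 (x)
    u: pi_a(1) = pi_a(pi_0(1)) = 0 for a > 0. *)
Lemma closure_graded_envelope : fin_gen M ->
  exists (M' : lmodType R) (gM : int -> {pred M'}) (f : {linear M -> M'}),
  [/\ graded_module G gM, fin_gen M', coprimary (irrelevant_ideal G) M',
      forall n, n \in N -> f n = 0
    & forall i u, extension_closure (phi i) (zero_submod M') (f u) ->
        extension_closure (phi i) N u].
Proof.
move=> fgM.
pose T i : zmodType := tquot (phi i) N.
pose E : lmodType R := coind T phi.
have prB a i : zmod_morphism (pr i a) by exact: raddfB.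
pose c0 a : E -> E := precomp (prB a).
have c0B a : zmod_morphism (c0 a) by move=> x y; apply: homsP.
pose c a : {additive E -> E} := HB.pack (c0 a) (GRing.isZmodMorphism.Build E E (c0 a) (c0B a)).
have cE a (x : E) i (s : S i) : capp (c a x) s = capp x (pr i a s) by [].
have bal i := tcls_balanced (phi i) N.
pose f0 (m : M) i (s : S i) : T i := \sum_(0 <= a < B) tcls (phi i) N (pr i a s) m.
have f0B m i : zmod_morphism (@f0 m i).
  move=> s t; rewrite /f0 -sumrB; apply: eq_bigr => a _.
  by rewrite raddfB (balancedBl (bal i)).
pose f1 (m : M) : E := homs_mk (f0B m).
have f1E m i s : capp (f1 m) s = @f0 m i s by [].
have f1D x y : f1 (x + y) = f1 x + f1 y.
  apply: homsP => i s; rewrite capp_addE !f1E /f0 -big_split.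
  by apply: eq_bigr => a _; rewrite (balancedDr (bal i)).
have f1Z r x : f1 (r *: x) = r *: f1 x.
  elim/(@homog_ind _ _ G): r => [|r t rx tx|d r rG].
  - by rewrite !scale0r; apply: (addrI (f1 0)); rewrite -f1D !addr0.
  - by rewrite !scalerDl f1D rx tx.
  apply: homsP => i s; rewrite capp_scaleE !f1E /f0.
  (* Moving r across the tensor sign shifts the range of degrees to d, ..., B + d - 1. The degrees
     below d contribute nothing by [prZ0], and those from B on nothing by [pr_vanish]. *)
  transitivity (\sum_(0 <= a < B + d) tcls (phi i) N (pr i a (phi i r * s)) x).
    rewrite [RHS](big_cat_nat (n := d)) ?leq_addl //= [X in _ = X + _]big_nat.
    rewrite [X in _ = X + _]big1 ?add0r => [|a /andP[_ ad]]; last first.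
      by rewrite (prZ0 _ rG ad); have := balancedBl (bal i) x 0 0; rewrite !subrr.
    rewrite -[X in _ = \big[_/_]_(X <= _ < _) _]add0n big_addn addnK; apply: eq_bigr => a _.
    by rewrite (prZ _ _ rG) (balancedZ (bal i)).
  rewrite (big_cat_nat (n := B)) ?leq_addr //= [X in _ + X]big_nat.
  rewrite [X in _ + X]big1 ?addr0 // => a /andP[Ba _].
  exact: pr_vanish.
have f1l : linear f1 by move=> a x y; rewrite f1D f1Z.
pose f : {linear M -> E} := HB.pack f1 (GRing.isLinear.Build _ _ _ _ f1 f1l).
have [] := @graded_envelope K R G E c _ _ _ M f B fgM.
- move=> a b x; apply: homsP => i s; rewrite !cE pr_pr eq_sym.
  by case: eqP => [->|_]; rewrite ?eqxx // raddf0.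
- move=> d a r x rG; apply: homsP => i s.
  by rewrite cE !capp_scaleE cE (prZ _ _ rG).
- move=> d a r x rG ad; apply: homsP => i s.
  by rewrite capp_scaleE cE (prZ0 _ rG ad) raddf0.
- move=> m; apply: homsP => i s; rewrite capp_sumE f1E /f0.
  rewrite big_nat [RHS]big_nat; apply: eq_bigr => a /andP[_ aB].
  rewrite cE f1E /f0 /index_iota subn0 (bigD1_seq a) ?mem_iota ?iota_uniq //=.
  rewrite pr_pr eqxx big1 ?addr0 // => b /negPf ba.
  by rewrite pr_pr ba; have := balancedBl (bal i) m 0 0; rewrite !subrr.
move=> M' [gM [f' [h [gMM fgM' cM' h_inj hf']]]].
exists M', gM, f'; split=> // [n nN|i u uN].
  apply: h_inj; rewrite hf' raddf0; apply: homsP => i s; rewrite f1E /f0 capp0E.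
  by rewrite big1 // => a _; apply: tcls_vanish.
have b : balanced (phi i) (fun (s : S i) g => capp (h g) s : T i).
  split=> [g s t|s g g'|r s g]; first exact: raddfB.
    by rewrite raddfD capp_addE.
  by rewrite linearZ capp_scaleE.
have := balanced_vanish b _ uN.
rewrite hf' f1E /f0 => /= H; apply/tcls_eq0; rewrite -[RHS]H; last first.
  by move=> s g /zero_submodP ->; rewrite raddf0 capp0E.
rewrite /index_iota subn0 (bigD1_seq 0%N) ?mem_iota ?iota_uniq //= pr1.
rewrite big1 ?addr0 // => a a0; rewrite -(pr1 i) pr_pr (negPf a0).
by have := balancedBl (bal i) u 0 0; rewrite !subrr.
Qed.

(** Since f is R-linear and kills N, the multiplier c for u also shows that f(u) is in the tight
    closure of 0. The index i is the exponent e for Frobenius closure, and the element of [unit] for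
    graded-plus closure. *)
Theorem tight_closure_sub_extension (p : nat) (pR : p \in [pchar R]) :
  (forall (M' : lmodType R) (gM : int -> {pred M'}) (N' : submodClosed M'),
     graded_module G gM -> graded_submod gM N' ->
     fin_gen M' -> fin_gen (submod N') ->
     coprimary (irrelevant_ideal G) (modquot N') ->
     forall u, tight_closure pR N' u -> exists i, extension_closure (phi i) N' u) ->
  fin_gen M -> forall u, tight_closure pR N u -> exists i, extension_closure (phi i) N u.
Proof.
move=> hyp fgM u [c [c_circ [e0 cu]]].
have [M' [gM [f [gMM fgM' cM' fN fS]]]] := closure_graded_envelope fgM.
have [||||||i uN] := hyp M' gM (zero_submod M') _ _ _ _ _ (f u) => //.
- by apply: graded_zero_submod; case: gMM => [[]].
- exact: fin_gen_zero_submod.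
- exact: coprimary_zero_submod.
- exists c; split=> //; exists e0 => e ee0; have := cu e ee0.
  rewrite /frob_elt -!tens_scale; apply: tensor_image_linear => n nN.
  by rewrite fN // rpred0.
by exists i; apply: fS.
Qed.

End Key.

(** * Frobenius closure *)

Lemma coprimary_power (K : fieldType) (R : comAlgType K) (G : standard_grading R)
    (M : lmodType R) (N : submodClosed M) :
  coprimary (irrelevant_ideal G) (modquot N) ->
  exists k, forall x m, x \in G 1%N -> x ^+ k *: m \in N.
Proof.
move=> [k kN]; exists k => x m xG; rewrite -[_ *: m]subr0; apply/modquot_eqP.
rewrite raddf0 linearZ /= kN //; exists 1%N, (fun=> 1), (fun _ _ => x); split.
  move=> _ _; exists [:: 1%N], (fun i => if i == 1%N then x else 0).
  split=> //=; last by rewrite big_seq1.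
  by move=> i; case: eqP => [->|_] //; apply: rpred0.
by rewrite big_ord1 mul1r prodr_const card_ord.
Qed.

(** Each x_l crosses the tensor sign and carries m into N. *)
Lemma tcls_sum_vanish (R S : comNzRingType) (phi : {rmorphism R -> S})
    (M : lmodType R) (N : submodClosed M) (n : nat) (x : 'I_n -> R) (a : 'I_n -> S) m :
  (forall l, x l *: m \in N) -> tcls phi N (\sum_l phi (x l) * a l) m = 0.
Proof.
move=> xN; have b := tcls_balanced phi N.
pose f s := tcls phi N s m.
have fB : zmod_morphism f by exact: balancedBl b m.
pose g : {additive S -> tquot phi N} := HB.pack f (GRing.isZmodMorphism.Build _ _ f fB).
rewrite -[LHS]/(g _) raddf_sum big1 // => l _ /=.
by rewrite /f (balancedZ b) tcls_vanish.
Qed.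

Section FrobeniusClosure.
Variables (K : fieldType) (R : comAlgType K) (G : standard_grading R).
Variables (p : nat) (pR : p \in [pchar R]).

Let q e := (p ^ e)%N.

Let q_gt0 e : (0 < q e)%N.
Proof. by rewrite expn_gt0 prime_gt0 // (pcharf_prime pR). Qed.

(** A form of degree d acts through F^e as a form of degree d q, so the degree of R has to be
    divided by q. Degrees not divisible by q become fractional and are dropped. *)
Let comp e a (s : R) : R := (hpoly G s)`_(a * q e).

Let comp_zmod e a : zmod_morphism (comp e a).
Proof. by move=> x y; rewrite /comp raddfB coefB. Qed.

Let comp_add e a : {additive R -> R} :=
  HB.pack (comp e a) (GRing.isZmodMorphism.Build R R (comp e a) (@comp_zmod e a)).

Theorem tight_closure_sub_frobenius_closure :
  (forall (M' : lmodType R) (gM : int -> {pred M'}) (N' : submodClosed M'),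
     graded_module G gM -> graded_submod gM N' ->
     fin_gen M' -> fin_gen (submod N') ->
     coprimary (irrelevant_ideal G) (modquot N') ->
     forall u, tight_closure pR N' u -> frobenius_closure pR N' u) ->
  forall (M : lmodType R) (N : submodClosed M), fin_gen M ->
    coprimary (irrelevant_ideal G) (modquot N) ->
    forall u, tight_closure pR N u -> frobenius_closure pR N u.
Proof.
move=> hyp M N fgM cN.
have [k kN] := coprimary_power cN.
have [xs [xsG xsF]] := piece_form_in G.
have frobG e d r : r \in G d -> frobenius pR e r \in G (d * q e)%N.
  by move=> rG; apply: pieceX.
apply: (tight_closure_sub_extension (I := nat) (S := fun=> R)
  (phi := frobenius pR) (pr := comp_add) _ _ _ _
  (B := (size xs * k).+1) _ _ hyp fgM) => //=.
- move=> e a b s; rewrite /comp (hpoly_homog (hpoly_piece G s _)) coefZ coefXn.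
  by rewrite eqn_pmul2r //; case: eqP; rewrite ?mulr1 ?mulr0.
- by move=> e a d r s /(frobG e) rG; rewrite /comp mulnDl (hpolyM_homog _ _ rG).
- move=> e a d r s /(frobG e) rG ad; rewrite /comp (hpolyM_homog_lt _ rG) //.
  by rewrite ltn_pmul2r.
- by move=> e; rewrite /comp rmorph1 coef1.
- move=> e a s m kB.
  (* Both sides scale by q, so one bound B serves every e; the pigeonhole then yields the powers
     x_l^(k q) = F^e(x_l^k). *)
  have kq : (size xs * (k * q e) < a * q e)%N by rewrite mulnA ltn_pmul2r.
  have [b] := form_in_powers kq (xsF _ _ (hpoly_piece G s (a * q e)%N)).
  rewrite -/(comp e a s) => ->.
  under eq_bigr => l _ do rewrite exprM -/(frobenius pR e _).
  by apply: tcls_sum_vanish => l; apply/kN/xsG/mem_nth.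
Qed.

(** The multiplier 1 works: base change along F^(e - e0) carries the relation for e0 to every e >=
    e0. *)
Lemma frobenius_closure_sub_tight_closure (M : lmodType R) (N : submodClosed M) u :
  frobenius_closure pR N u -> tight_closure pR N u.
Proof.
move=> [e0 uN]; exists 1; split.
  by move=> P _; rewrite idealr1.
exists e0 => e ee0; rewrite scale1r.
apply: (extension_closure_comp (psi := frobenius pR (e - e0)) _ uN) => r.
by rewrite /= /frobenius -exprM -expnD subnKC.
Qed.

End FrobeniusClosure.

(** * Plus closure *)

Section Functional.
Variables (F : fieldType) (L : fieldType) (iota : {rmorphism F -> L}).

Let avoids1 (W : set L) :=
  (forall x y, W x -> W y -> W (x + y)) /\ (forall a x, W x -> W (iota a * x)) /\ ~ W 1.

(* A maximal F-subspace avoiding 1 is a complement of F. *)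
Lemma exists_linear_retraction : exists l : L -> F,
  [/\ forall x y, l (x + y) = l x + l y, forall a x, l (iota a * x) = a * l x
    & l 1 = 1].
Proof.
have [C CP Ctot|W [[WD [WZ W1]] Wmax]] := @Zorn_bigcup L [set W | avoids1 W].
  split=> [x y [X CX Xx] [Y CY Yy]|].
    have [XY|YX] := Ctot X Y CX CY.
      by exists Y => //; apply: (CP Y CY).1 => //; apply: XY.
    by exists X => //; apply: (CP X CX).1 => //; apply: YX.
  split=> [a x [X CX Xx]|[X CX X1]]; first by exists X => //; apply: (CP X CX).2.1.
  by case: (CP X CX) => _ [_]; apply.
(* The condition [avoids1] admits the empty set, as the union of the empty chain requires; 0 is
   therefore adjoined to W. *)
pose V x := W x \/ x = 0.
have VD x y : V x -> V y -> V (x + y).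
  move=> [Wx|->] [Wy|->]; rewrite ?add0r ?addr0; [left; exact: WD|by left|by left|by right].
have VZ a x : V x -> V (iota a * x).
  by move=> [Wx|->]; [left; apply: WZ | right; rewrite mulr0].
have V1 : ~ V 1 by move=> [//|/eqP]; rewrite oner_eq0.
have Vex x : exists a, V (x - iota a).
  apply: contrapT => nV.
  pose W' y := exists w a, V w /\ y = w + iota a * x.
  apply: (Wmax W').
    split=> [w Ww|W'W]; first by exists w, 0; rewrite rmorph0 mul0r addr0; split=> //; left.
    apply: nV; exists 0; rewrite rmorph0 subr0; left; apply: W'W.
    by exists 0, 1; rewrite rmorph1 mul1r add0r; split=> //; right.
  split=> [y z [w [a [Vw ->]]] [w' [a' [Vw' ->]]]|].
    by exists (w + w'), (a + a'); split; [apply: VD | rewrite rmorphD mulrDl addrACA].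
  split=> [b y [w [a [Vw ->]]]|[w [a [Vw aw]]]].
    by exists (iota b * w), (b * a); split; [apply: VZ | rewrite rmorphM mulrDr mulrA].
  have a0 : a != 0.
    by apply/eqP => a0; apply: V1; rewrite aw a0 rmorph0 mul0r addr0.
  apply: nV; exists a^-1; have -> : x - iota a^-1 = iota (- a^-1) * w.
    have -> : w = 1 - iota a * x by rewrite aw addrK.
    rewrite rmorphN mulNr mulrBr mulr1 mulrA -rmorphM mulVf // rmorph1 mul1r.
    by rewrite opprB.
  exact: VZ.
have Vuniq x a b : V (x - iota a) -> V (x - iota b) -> a = b.
  move=> Va Vb; apply/eqP; rewrite -subr_eq0; apply: contra_notT V1 => ab.
  have -> : 1 = iota (a - b)^-1 * ((x - iota b) + iota (- 1) * (x - iota a)).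
    have -> : (x - iota b) + iota (- 1) * (x - iota a) = iota (a - b).
      by rewrite rmorphN1 mulN1r opprB rmorphB addrC addrA subrK.
    by rewrite -rmorphM mulVf // rmorph1.
  by apply/VZ/VD => //; apply: VZ.
exists (fun x => sval (cid (Vex x))); split=> [x y|a x|].
- case: (cid (Vex (x + y))) (cid (Vex x)) (cid (Vex y)) => c Vc [a Va] [b Vb] /=.
  by apply: Vuniq Vc _; rewrite rmorphD opprD addrACA; apply: VD.
- case: (cid (Vex (iota a * x))) (cid (Vex x)) => c Vc [b Vb] /=.
  by apply: Vuniq Vc _; rewrite rmorphM -mulrBr; apply: VZ.
- case: (cid (Vex 1)) => c Vc /=; apply: Vuniq Vc _.
  by rewrite rmorph1 subrr; right.
Qed.

End Functional.

Lemma fraction_denominator (R : idomainType) (x : {fraction R}) :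
  exists c r : R, c != 0 /\ @tofrac R r = @tofrac R c * x.
Proof.
elim/quotW: x => y; exists (frac y).2, (frac y).1; split; first exact: denom_ratioP.
unlock tofrac; rewrite !piE; apply/eqmodP => /=.
have d0 : (frac y).2 != 0 by apply: denom_ratioP.
rewrite FracField.equivfE /FracField.mulf /= !numden_Ratio ?mul1r ?mulr1 ?oner_eq0 //.
by rewrite mulrC.
Qed.

Lemma root_monic_pow (R S : comNzRingType) (phi : {rmorphism R -> S}) (f : {poly R}) x :
  f \is monic -> root (map_poly phi f) x ->
  x ^+ (size f).-1 = - \sum_(i < (size f).-1) phi f`_i * x ^+ i.
Proof.
move=> fm /rootP; have sf : size (map_poly phi f) = size f.
  by apply: size_map_poly_id0; rewrite (monicP fm) rmorph1 oner_eq0.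
set t := (size f).-1; have ft : size f = t.+1.
  by rewrite prednK // size_poly_gt0 monic_neq0.
rewrite horner_coef sf ft big_ord_recr /= coef_map -/(lead_coef f) (monicP fm).
rewrite [X in _ + X * _](rmorph1 phi) mul1r.
move=> /eqP; rewrite addrC addr_eq0 => /eqP ->; congr (- _).
by apply: eq_bigr => i _; rewrite coef_map.
Qed.

(** * Plus closure lies in tight closure *)

Section PlusInTight.
Local Open Scope quotient_scope.
Variables (R : idomainType) (L : closedFieldType).
Variables (iota : {rmorphism {fraction R} -> L}).

(** R[s] is generated as an R-module by 1, s, ..., s^(t-1), so a common denominator of the values of
    l there serves for all powers of s. *)
Lemma integral_powers_denominator (l : L -> {fraction R}) :
  (forall x y, l (x + y) = l x + l y) -> (forall a x, l (iota a * x) = a * l x) ->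
  forall s, integralOver (frac_emb iota) s ->
  exists c : R, c != 0 /\ forall n, exists r : R, @tofrac R r = @tofrac R c * l (s ^+ n).
Proof.
move=> lD lZ s [f fm fs]; set t := (size f).-1.
have [c [c0 cP]] : exists c : R, c != 0 /\ forall n, (n < t)%N ->
    exists r : R, @tofrac R r = @tofrac R c * l (s ^+ n).
  elim: t => [|t [c [c0 cP]]]; first by exists 1; rewrite oner_neq0.
  have [d [r [d0 dr]]] := fraction_denominator (l (s ^+ t)).
  exists (c * d); split=> [|n]; first by rewrite mulf_neq0.
  rewrite ltnS leq_eqVlt => /orP[/eqP->|/cP[r' r'E]].
    by exists (c * r); rewrite !tofracM dr mulrA.
  by exists (d * r'); rewrite !tofracM r'E mulrCA mulrA.
have l0 : l 0 = 0 by have := lZ 0 0; rewrite !(mul0r, rmorph0).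
exists c; split=> //; elim/ltn_ind => n IH.
have [/cP //|tn] := ltnP n t.
have -> : s ^+ n = \sum_(i < t) iota (- @tofrac R f`_i) * s ^+ (i + (n - t)).
  rewrite -{1}(subnKC tn) exprD (root_monic_pow fm fs) mulNr mulr_suml -sumrN.
  by apply: eq_bigr => i _; rewrite exprD rmorphN mulNr mulrA.
elim/big_ind: _ => [|x y [r rE] [r' r'E]|i _].
- by exists 0; rewrite l0 mulr0 tofrac0.
- by exists (r + r'); rewrite tofracD rE r'E lD mulrDr.
- have [|r rE] := IH (i + (n - t))%N; first by rewrite -{2}(subnKC tn) ltn_add2r.
  by exists (- f`_i * r); rewrite lZ tofracM rE tofracN mulrCA.
Qed.

(** In a domain the zero ideal is prime, hence the only minimal prime. *)
Lemma ring_circ_neq0 (c : R) : c != 0 -> ring_circ c.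
Proof.
move=> c0 P Pmin; apply: contraNN c0 => cP.
have Z0 : idealr_closed (pred1 (0 : R)).
  split=> [||a x y]; rewrite ?inE ?eqxx ?oner_eq0 //.
  by move=> /eqP -> /eqP ->; rewrite mulr0 addr0.
have Zp : prime_idealr_closed (pred1 (0 : R)) by move=> x y; rewrite !inE mulf_eq0.
pose Z : prime_idealr R := HB.pack (pred1 (0 : R) : R -> bool)
  (isIdealr.Build R (pred1 0) Z0) (isPrimeIdealrClosed.Build R (pred1 0) Zp).
have ZP : {subset Z <= P} by move=> x /eqP ->; apply: rpred0.
by have := Pmin Z ZP c; rewrite cP => /eqP ->.
Qed.

(** Let l be a linear retraction of L onto Frac R. From 1 (x) u = sum_i s_i (x) n_i with s_i in R^+,
    take q-th powers, apply l and multiply by a common denominator c of all the l(s_i^q): then c u^q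
    = sum_i c l(s_i^q) n_i^q, with the same c for every q. *)
Theorem plus_closure_sub_tight_closure (p : nat) (pR : p \in [pchar R])
    (M : lmodType R) (N : submodClosed M) u :
  plus_closure iota N u -> tight_closure pR N u.
Proof.
move=> uN; have [l [lD lZ l1]] := exists_linear_retraction iota.
pose S : comNzRingType := subring (plus_pred iota).
pose T e : zmodType := tquot (frobenius pR e) N.
pose V := dprod (fun c : R => dprod T).
(* The denominator depends on s, while a balanced map has to be defined for all s at once. So c is
   kept as a variable, and families are identified when they agree at all multiples of some nonzero
   c0. *)
pose Z : {pred V} := fun v => `[< exists c0, c0 != 0 /\ forall c e, v (c0 * c) e = 0 >].
have Zz : zmod_closed Z.
  split=> [|v w /asboolP[a [a0 av]] /asboolP[b [b0 bw]]]; apply/asboolP.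
    by exists 1; rewrite oner_neq0.
  exists (a * b); split=> [|c e]; first by rewrite mulf_neq0.
  by rewrite !dprodE -mulrA av mulrCA bw subrr.
pose Zc : zmodClosed V := HB.pack Z (GRing.isZmodClosed.Build V Z Zz).
(* The default 0 outside R is invisible modulo [Z], where c may be taken divisible by a
   denominator. *)
pose num (x : {fraction R}) : R :=
  if pselect (exists r : R, @tofrac R r = x) is left h then sval (cid h) else 0.
have numE r : num (@tofrac R r) = r.
  rewrite /num; case: pselect => [h|[]]; last by exists r.
  by case: (cid h) => r' /= /eqP; rewrite tofrac_eq => /eqP.
pose theta c e (s : S) : R := num (@tofrac R c * l (val s ^+ (p ^ e))).
have thetaE c e s r : @tofrac R r = @tofrac R c * l (val s ^+ (p ^ e)) -> theta c e s = r.
  by move=> rE; rewrite /theta -rE numE.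
have lN x : l (- x) = - l x by have := lZ (-1) x; rewrite rmorphN1 !mulN1r.
have theta_den s : exists c0, c0 != 0 /\ forall c e,
    @tofrac R (theta (c0 * c) e s) = @tofrac R (c0 * c) * l (val s ^+ (p ^ e)).
  have /asboolP s_int := valP s.
  have [c0 [c00 c0P]] := integral_powers_denominator lD lZ s_int.
  exists c0; split=> // c e; have [r rE] := c0P (p ^ e)%N.
  have E : @tofrac R (c * r) = @tofrac R (c0 * c) * l (val s ^+ (p ^ e)).
    by rewrite !tofracM rE mulrA [_ * tofrac c0]mulrC.
  by rewrite (thetaE _ _ _ _ E).
have pL : p \in [pchar L] by apply: (rmorph_pchar (frac_emb iota)).
pose v (s : S) (m : M) : V := fun c e => tcls (frobenius pR e) N (theta c e s) m.
pose b (s : S) (m : M) : Quotient.quot Zc := \pi_(Quotient.quot Zc) (v s m).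
have piP x y : (exists c0, c0 != 0 /\ forall c e, x (c0 * c) e = y (c0 * c) e) ->
    \pi_(Quotient.quot Zc) x = \pi_(Quotient.quot Zc) y.
  move=> [c0 [c00 xy]]; apply/eqP; rewrite -Quotient.idealrBE; apply/asboolP.
  by exists c0; split=> // c e; rewrite !dprodE xy subrr.
have bal e := tcls_balanced (frobenius pR e) N.
have bB : balanced (plus_emb iota) b.
  split=> [m s t|s x y|r s m]; rewrite /b.
  - rewrite -raddfB; apply: piP.
    have [c [c0 cs]] := theta_den s; have [d [d0 dt]] := theta_den t.
    exists (c * d); split=> [|a e]; first by rewrite mulf_neq0.
    rewrite !dprodE /v -(balancedBl (bal e)); congr tcls; apply: thetaE.
    have := cs (d * a) e; have := dt (c * a) e.
    rewrite [d * (c * a)]mulrCA mulrA => dE cE; rewrite tofracB dE cE.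
    rewrite -mulrBr -lN -lD; congr (_ * l _); symmetry.
    exact: (frobenius_zmod pL).
  - rewrite -raddfD; apply: piP; exists 1; rewrite oner_neq0; split=> // c e.
    by rewrite dprodDE /v (balancedDr (bal e)).
  - apply: piP; have [c [c0 cs]] := theta_den s.
    exists c; split=> // a e; rewrite /v -(balancedZ (bal e)); congr tcls.
    apply: thetaE; rewrite (tofracM (frobenius pR e r)) cs mulrCA; congr (_ * _).
    have E : frac_emb iota r ^+ (p ^ e) = iota (@tofrac R (frobenius pR e r)).
      by rewrite /frobenius tofracXn rmorphXn.
    by rewrite -[val (_ * s)]/(frac_emb iota r * val s) exprMn E lZ.
have bN s n : n \in N -> b s n = 0.
  move=> nN; rewrite /b -[RHS](raddf0 (\pi_(Quotient.quot Zc))); apply: piP.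
  by exists 1; rewrite oner_neq0; split=> // c e; rewrite /v tcls_vanish.
have := balanced_vanish bB bN uN.
rewrite /b -[RHS](raddf0 (\pi_(Quotient.quot Zc))) => /eqP.
rewrite -Quotient.idealrBE subr0 => /asboolP[c [c0 cv]].
exists c; split; first exact: ring_circ_neq0.
exists 0%N => e _; rewrite /frob_elt -tens_scale; apply/tcls_eq0.
have := cv 1 e; rewrite mulr1 /v; congr (tcls _ _ _ _ = 0); apply: thetaE.
by rewrite /= expr1n l1 mulr1.
Qed.

End PlusInTight.

(** * The grading of R^+GR *)

Lemma frobenius_inj (A : idomainType) (p : nat) (pA : p \in [pchar A]) e (x y : A) :
  x ^+ (p ^ e) = y ^+ (p ^ e) -> x = y.
Proof.
move=> xy; apply/eqP; rewrite -subr_eq0.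
have : frobenius pA e (x - y) == 0 by rewrite raddfB /frobenius /= /frobenius xy subrr.
by rewrite /frobenius expf_eq0 => /andP[].
Qed.

Lemma integralOver_exp (R S : comNzRingType) (phi : {rmorphism R -> S}) (x : S) n :
  (0 < n)%N -> integralOver phi (x ^+ n) -> integralOver phi x.
Proof.
move=> n0 xn; apply: (integral_root_monic (p := 'X^n - (x ^+ n)%:P)).
- by rewrite monicXnsubC.
- by rewrite /root hornerD hornerN hornerXn hornerC subrr.
apply/integral_poly => i; rewrite coefB coefXn coefC; apply: integral_sub.
  exact: integral_nat.
by case: eqP => // _; apply: integral0.
Qed.

Lemma integralOver_sum (R S : comNzRingType) (phi : {rmorphism R -> S})
    (I : Type) (r : seq I) (P : pred I) (F : I -> S) :
  (forall i, P i -> integralOver phi (F i)) -> integralOver phi (\sum_(i <- r | P i) F i).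
Proof.
move=> PF; elim/big_ind: _ => //; first exact: integral0.
by move=> x y; apply: integral_add.
Qed.

Section GradedPlus.
Variables (K : fieldType) (R : idomAlgType K) (G : standard_grading R).
Variables (L : closedFieldType) (iota : {rmorphism {fraction R} -> L}).

Local Notation emb := (frac_emb iota).

(* [rho N] sends a form [r] of degree d to [r X^(N d)]; an element of L is
   homogeneous of degree k/N exactly when its multiple by [X^k] is integral over
   [rho N]. *)
Definition rho (N : nat) : {rmorphism R -> {poly L}} :=
  (comp_poly 'X^N \o map_poly emb) \o hpoly G.

Definition homog (N k : nat) (x : L) := integralOver (rho N) (x *: 'X^k).

Lemma rhoE N r : rho N r = map_poly emb (hpoly G r) \Po 'X^N.
Proof. by []. Qed.

Lemma rho_homog N d r : r \in G d -> rho N r = emb r *: 'X^(N * d).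
Proof.
move=> rG; rewrite rhoE (hpoly_homog rG) map_polyZ map_polyXn comp_polyZ.
by rewrite comp_Xn_poly -exprM.
Qed.

Lemma rho_coef N r i : (0 < N)%N ->
  (rho N r)`_i = if (N %| i)%N then emb (hpoly G r)`_(i %/ N) else 0.
Proof. by move=> N0; rewrite rhoE coef_comp_poly_Xn // coef_map. Qed.

Lemma rho1E N r : (rho N r).[1] = emb r.
Proof.
by rewrite rhoE horner_comp hornerXn expr1n -(rmorph1 emb) horner_map hpoly1E.
Qed.

Lemma homog0 N k : homog N k 0.
Proof. by rewrite /homog scale0r; apply: integral0. Qed.

Lemma homogB N k x y : homog N k x -> homog N k y -> homog N k (x - y).
Proof. by rewrite /homog scalerBl; apply: integral_sub. Qed.

Lemma homogM N k l x y : homog N k x -> homog N l y -> homog N (k + l) (x * y).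
Proof.
rewrite /homog exprD -scalerA => xk yl.
have -> : x *: (y *: ('X^k * 'X^l)) = (x *: 'X^k) * (y *: 'X^l).
  by rewrite -scalerAl -scalerAr.
exact: integral_mul.
Qed.

Lemma homog_emb N d r : r \in G d -> homog N (N * d) (emb r).
Proof. by move=> rG; rewrite /homog -(rho_homog N rG); apply: integral_id. Qed.

Lemma homog_scale N k m x : homog N k x -> homog (N * m) (k * m) x.
Proof.
move=> /(@integral_rmorph _ _ _ _ (comp_poly 'X^m)) [P Pm Px].
exists P => //; move: Px; rewrite /= comp_polyZ comp_Xn_poly -exprM mulnC.
rewrite (@eq_map_poly _ _ _ (rho (N * m))) // => r /=.
by rewrite -comp_polyA comp_Xn_poly -exprM mulnC.
Qed.

(** Multiplied by X^(k t), the equation of f becomes one for f X^k over [rho N], because r_i has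
    degree i k/N and is sent to r_i X^(k i). *)
Lemma GR_homogeneous_homog (d : rat) N k f : d * N%:R = k%:R ->
  GR_homogeneous G iota d f -> homog N k f.
Proof.
move=> dN [t [r [rG]]]; case: t rG => [|t] rG.
  by rewrite big_geq // expr0 addr0 => /eqP; rewrite oner_eq0.
move=> f0.
have rhor i : (0 < i <= t.+1)%N -> rho N (r i) = emb (r i) *: 'X^(k * i).
  move=> /rG[->|[n [dn /(rho_homog N) ->]]].
    by rewrite !rmorph0 scale0r.
  congr (_ *: 'X^_); apply/eqP; rewrite -(eqr_nat rat) natrM -dn mulrCA mulrC.
  by rewrite [N%:R * _]mulrC dN natrM mulrC.
pose Q : {poly R} := \sum_(1 <= i < t.+2) r i *: 'X^(t.+1 - i).
exists ('X^(t.+1) + Q).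
  rewrite monicE lead_coefDl ?lead_coefXn // size_polyXn ltnS.
  rewrite /Q big_nat; apply: (leq_trans (size_sum _ _ _)); apply/bigmax_leqP_seq => i _ /andP[i1 it].
  rewrite (leq_trans (size_scale_leq _ _)) // size_polyXn; lia.
rewrite /root rmorphD rmorph_sum /= map_polyXn hornerD hornerXn horner_sum.
have E j : (f *: 'X^k) ^+ j = f ^+ j *: 'X^(k * j) by rewrite exprZn -exprM.
have -> : \sum_(1 <= i < t.+2) (map_poly (rho N) (r i *: 'X^(t.+1 - i))).[f *: 'X^k]
  = (\sum_(1 <= i < t.+2) emb (r i) * f ^+ (t.+1 - i)) *: 'X^(k * t.+1).
  rewrite scaler_suml big_nat [RHS]big_nat; apply: eq_bigr => i it.
  rewrite map_polyZ map_polyXn hornerZ hornerXn E rhor //.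
  rewrite -scalerAl -scalerAr scalerA -exprD -mulnDr subnKC //.
  by case/andP: it.
by rewrite E -scalerDl f0 scale0r.
Qed.

Lemma GR_homogeneous_ge0 (d : rat) f : 0 <= d -> GR_homogeneous G iota d f ->
  exists N k, (0 < N)%N /\ homog N k f.
Proof.
move=> d0 fd; exists `|denq d|%N, `|numq d|%N; split.
  by rewrite absz_gt0 denq_neq0.
apply: GR_homogeneous_homog fd.
have -> : (`|denq d|%N)%:R = (denq d)%:~R :> rat.
  by rewrite -[in RHS](gtz0_abs (denq_gt0 d)).
have -> : (`|numq d|%N)%:R = (numq d)%:~R :> rat.
  by rewrite -[in RHS](gez0_abs (_ : 0 <= numq d)) // numq_ge0.
by rewrite -{1}[d]divq_num_den divfK // intr_eq0 denq_neq0.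
Qed.

(** The coefficient of X^(k t) in a monic equation of degree t for f X^k retains, from each
    coefficient, just the component of the required degree, or 0 if that degree is not an
    integer. *)
Lemma homog_GR_homogeneous N k f : (0 < N)%N -> homog N k f ->
  GR_homogeneous G iota (k%:R / N%:R) f.
Proof.
move=> N0 [P Pm Px]; set t := (size P).-1.
pose r j := if (N %| k * j)%N then (hpoly G P`_(t - j))`_((k * j) %/ N) else 0 : R.
have rE j : emb (r j) = (rho N P`_(t - j))`_(k * j).
  by rewrite rho_coef // /r; case: ifP => // _; rewrite rmorph0.
exists t, r; split=> [j _|].
  rewrite /r; case: ifP => [Nj|_]; last by left.
  right; exists ((k * j) %/ N)%N; split; last exact: hpoly_piece.
  have N0' : N%:R != 0 :> rat by rewrite pnatr_eq0 -lt0n.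
  by apply: (mulIf N0'); rewrite mulrA divfK // -!natrM divnK // mulnC.
have /(congr1 (fun g : {poly L} => g`_(k * t))) := root_monic_pow Pm Px.
have E j : (f *: 'X^k) ^+ j = f ^+ j *: 'X^(k * j) by rewrite exprZn -exprM.
rewrite -/t E coefZ coefXn eqxx mulr1 => ->.
rewrite coefN coef_sum big_add1 succnK big_nat_rev add0n big_mkord addrC; apply/eqP.
rewrite subr_eq0; apply/eqP; apply: eq_bigr => i _.
have it : (i <= t)%N by apply: ltnW.
rewrite subnSK // subKn // rE subKn // E -scalerAr coefZ coefMXn ltnNge leq_mul2l it orbT /=.
by rewrite -mulnBr mulrC.
Qed.

(* Evaluating at X = 1 turns an equation of minimal size satisfied by [g] into one
   with zero constant term, which can then be divided by [g]. *)
Lemma integral_rho_inj N (g : {poly L}) :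
  integralOver (rho N) g -> g.[1] = 0 -> g = 0.
Proof.
move=> [P /monic_neq0 P0 Pg] g1; apply/eqP/negPn/negP => g0.
elim/poly_ind: P P0 Pg => [|P c IH] P0 Pg; first by rewrite eqxx in P0.
have {}Pg : (map_poly (rho N) P).[g] * g + rho N c = 0.
  by move/rootP: Pg; rewrite rmorphD rmorphM /= map_polyX map_polyC hornerMXaddC.
have c0 : c = 0.
  have /eqP := congr1 (horner^~ 1) Pg.
  rewrite hornerD hornerM g1 mulr0 add0r rho1E hornerC.
  by rewrite -[emb c]/(iota (tofrac c)) fmorph_eq0 tofrac_eq0 => /eqP.
move: P0 Pg; rewrite c0 !rmorph0 !addr0 => P0 /eqP.
rewrite mulf_eq0 (negPf g0) orbF => Pg; apply: IH => //.
by apply: contraNneq P0 => ->; rewrite mul0r.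
Qed.

(** Such a g encodes the element g(1) with its components, the coefficient of X^k being the one of
    degree k/N. Different denominators are reconciled by substituting X^m for X. *)
Definition homog_decomp (N : nat) (g : {poly L}) := (0 < N)%N /\ forall k, homog N k g`_k.

Lemma homog_decomp_scale N m g :
  (0 < m)%N -> homog_decomp N g -> homog_decomp (N * m) (g \Po 'X^m).
Proof.
move=> m0 [N0 gN]; split=> [|k]; first by rewrite muln_gt0 N0.
rewrite coef_comp_poly_Xn //; case: ifP => [mk|_]; last exact: homog0.
by rewrite -{1}(divnK mk); apply: homog_scale.
Qed.

Lemma homog_decomp_integral N g : homog_decomp N g -> integralOver (rho N) g.
Proof.
move=> [_ gN]; rewrite -[g]coefK poly_def; apply: integralOver_sum => i _.
exact: gN.
Qed.

Lemma homog_decompB N g h :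
  homog_decomp N g -> homog_decomp N h -> homog_decomp N (g - h).
Proof. by move=> [N0 gN] [_ hN]; split=> // k; rewrite coefB; apply: homogB. Qed.

Lemma homogD N k x y : homog N k x -> homog N k y -> homog N k (x + y).
Proof.
by move=> xk yk; rewrite -[y]opprK -[- y]sub0r; do 2!apply: homogB => //; apply: homog0.
Qed.

Lemma homog_decompM N g h :
  homog_decomp N g -> homog_decomp N h -> homog_decomp N (g * h).
Proof.
move=> [N0 gN] [_ hN]; split=> // k; rewrite coefM.
elim/big_ind: _ => [|x y|i _]; [exact: homog0|exact: homogD|].
by rewrite -{1}(subnKC (ltnSE (ltn_ord i))); apply: homogM.
Qed.

Lemma homog_decomp_monom N k x :
  (0 < N)%N -> homog N k x -> homog_decomp N (x *: 'X^k).
Proof.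
move=> N0 xk; split=> // j; rewrite coefZ coefXn.
by case: eqP => [->|_]; rewrite ?mulr1 ?mulr0 //; apply: homog0.
Qed.

Lemma homog_decomp_uniq N N' g g' a :
  homog_decomp N g -> homog_decomp N' g' -> g.[1] = g'.[1] ->
  g`_(a * N) = g'`_(a * N').
Proof.
move=> gN g'N' gg'; have [N0 _] := gN; have [N'0 _] := g'N'.
have gN1 := homog_decomp_scale N'0 gN.
have := homog_decomp_scale N0 g'N'; rewrite mulnC => g'N1.
have /eqP : (g \Po 'X^N') - (g' \Po 'X^N) = 0.
  apply: (integral_rho_inj (homog_decomp_integral (homog_decompB gN1 g'N1))).
  by rewrite hornerD hornerN !horner_comp !hornerXn !expr1n gg' subrr.
rewrite subr_eq0 => /eqP /(congr1 (fun h : {poly L} => h`_(a * N * N'))).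
rewrite !coef_comp_poly_Xn // dvdn_mull // mulnK //.
by rewrite mulnAC dvdn_mull // mulnK.
Qed.

(** The elements with a decomposition form a subring, by passing to common denominators, and it
    contains the generators of R^+GR. *)
Lemma plusGR_decomp x : x \in plusGR_pred G iota ->
  exists N g, homog_decomp N g /\ g.[1] = x.
Proof.
pose D x := exists N g, homog_decomp N g /\ g.[1] = x.
have common u v : D u -> D v -> exists N g h,
    [/\ homog_decomp N g, homog_decomp N h, g.[1] = u & h.[1] = v].
  move=> [N [g [gN gx]]] [N' [h [hN' hy]]]; have [N0 _] := gN; have [N'0 _] := hN'.
  exists (N * N')%N, (g \Po 'X^N'), (h \Po 'X^N); split.
  - exact: homog_decomp_scale.
  - by rewrite mulnC; apply: homog_decomp_scale.
  - by rewrite horner_comp hornerXn expr1n.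
  - by rewrite horner_comp hornerXn expr1n.
pose Dp : {pred L} := fun x => `[< D x >].
have Dc : subring_closed Dp.
  split=> [|u v /asboolP Du /asboolP Dv|u v /asboolP Du /asboolP Dv]; apply/asboolP.
  - exists 1%N, ((1 : L) *: 'X^0); split; last by rewrite hornerZ hornerXn expr0 mulr1.
    apply: homog_decomp_monom => //; rewrite -(rmorph1 emb) -(muln0 1).
    exact/homog_emb/piece1.
  - have [N [g [h [gN hN gu hv]]]] := common _ _ Du Dv.
    exists N, (g - h); split; first exact: homog_decompB.
    by rewrite hornerD hornerN gu hv.
  - have [N [g [h [gN hN gu hv]]]] := common _ _ Du Dv.
    by exists N, (g * h); split; [apply: homog_decompM | rewrite hornerM gu hv].
pose DS : subringClosed L := HB.pack Dp (GRing.isSubringClosed.Build L Dp Dc).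
move=> /asboolP /(_ DS) xD; apply/asboolP; apply: xD => f; rewrite inE => -[d [d0 fd]].
have [N [k [N0 fh]]] := GR_homogeneous_ge0 d0 fd.
apply/asboolP; exists N, (f *: 'X^k); split; last by rewrite hornerZ hornerXn expr1n mulr1.
exact: homog_decomp_monom.
Qed.

Lemma homog_plusGR N k x : (0 < N)%N -> homog N k x -> x \in plusGR_pred G iota.
Proof.
move=> N0 xk; apply/asboolP => S; apply; rewrite inE.
exists (k%:R / N%:R); split; last exact: homog_GR_homogeneous.
by rewrite divr_ge0 ?ler0n.
Qed.

End GradedPlus.

(** * Projections of R^+GR onto the integer degrees, and p-th roots *)

Section GradedPlusComponents.
Variables (K : fieldType) (R : idomAlgType K) (G : standard_grading R).
Variables (L : closedFieldType) (iota : {rmorphism {fraction R} -> L}).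

Local Notation emb := (frac_emb iota).
Local Notation S := (subring (plusGR_pred G iota)).
Local Notation decomp := (homog_decomp G iota).

Lemma plusGR_component_exists (x : S) a : exists y : S, forall N g,
  decomp N g -> g.[1] = val x -> val y = g`_(a * N).
Proof.
have [N [g [gN gx]]] := plusGR_decomp (valP x).
have [N0 gh] := gN; exists (Subring (homog_plusGR N0 (gh (a * N)%N))) => N' g' g'N' g'x.
by apply: homog_decomp_uniq gN g'N' _; rewrite gx g'x.
Qed.

Definition grcomp a (x : S) : S := sval (cid (plusGR_component_exists x a)).

Lemma grcompE a x N g : decomp N g -> g.[1] = val x -> val (grcomp a x) = g`_(a * N).
Proof. by rewrite /grcomp; case: cid => y /= yE; apply: yE. Qed.

Fact grcomp_zmod a : zmod_morphism (grcomp a).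
Proof.
move=> x y; have [N [g [gN gx]]] := plusGR_decomp (valP x).
have [N' [g' [g'N gy]]] := plusGR_decomp (valP y); have [N0 _] := gN; have [N'0 _] := g'N.
have hN := homog_decomp_scale N'0 gN.
have := homog_decomp_scale N0 g'N; rewrite mulnC => h'N.
have hx : (g \Po 'X^N').[1] = val x by rewrite horner_comp hornerXn expr1n.
have hy : (g' \Po 'X^N).[1] = val y by rewrite horner_comp hornerXn expr1n.
apply: val_inj; rewrite -[RHS]/(val (grcomp a x) - val (grcomp a y)).
rewrite (grcompE a hN hx) (grcompE a h'N hy).
rewrite (grcompE a (homog_decompB hN h'N)) ?coefB //.
by rewrite hornerD hornerN hx hy.
Qed.

HB.instance Definition _ a := GRing.isZmodMorphism.Build S S (grcomp a) (@grcomp_zmod a).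

Lemma grcomp_homog a x : homog G iota 1 a (val (grcomp a x)).
Proof.
have [N [g [gN gx]]] := plusGR_decomp (valP x); have [N0 gh] := gN.
rewrite (grcompE a gN gx); apply: (@GR_homogeneous_homog _ _ _ _ _ a%:R); rewrite ?mulr1 //.
have := homog_GR_homogeneous N0 (gh (a * N)%N).
by rewrite natrM mulfK // pnatr_eq0 -lt0n.
Qed.

Lemma grcomp_grcomp a b x : grcomp a (grcomp b x) = if a == b then grcomp b x else 0.
Proof.
have dN := homog_decomp_monom (ltn0Sn 0) (grcomp_homog b x).
apply: val_inj; rewrite (grcompE a dN); last by rewrite hornerZ hornerXn expr1n mulr1.
by rewrite muln1 coefZ coefXn; case: eqP; rewrite ?mulr1 ?mulr0.
Qed.

Lemma grcompM_decomp d r x : r \in G d -> exists N g, [/\ decomp N g, g.[1] = val x,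
  decomp N (emb r *: 'X^(N * d) * g) &
  (emb r *: 'X^(N * d) * g).[1] = val (plusGR_emb G iota r * x)].
Proof.
move=> rG; have [N [g [gN gx]]] := plusGR_decomp (valP x); have [N0 _] := gN.
exists N, g; split=> //.
  by apply: homog_decompM gN; apply: homog_decomp_monom (homog_emb _ _ _).
by rewrite hornerM hornerZ hornerXn expr1n mulr1 gx.
Qed.

Lemma grcompM a d r x : r \in G d ->
  grcomp (a + d) (plusGR_emb G iota r * x) = plusGR_emb G iota r * grcomp a x.
Proof.
move=> rG; have [N [g [gN gx hN hx]]] := grcompM_decomp x rG.
apply: val_inj; rewrite (grcompE _ hN hx) -[RHS]/(emb r * val (grcomp a x)) (grcompE a gN gx).
by rewrite -scalerAl coefZ coefXnM mulnDl (mulnC N) ltnNge leq_addl /= addnK.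
Qed.

Lemma grcompM_lt a d r x : r \in G d -> (a < d)%N ->
  grcomp a (plusGR_emb G iota r * x) = 0.
Proof.
move=> rG ad; have [N [g [gN gx hN hx]]] := grcompM_decomp x rG; have [N0 _] := gN.
apply: val_inj; rewrite (grcompE _ hN hx).
by rewrite -scalerAl coefZ coefXnM (mulnC N) ltn_pmul2r // ad mulr0.
Qed.

Lemma grcomp1 : grcomp 0 1 = 1.
Proof.
have h1 : homog G iota 1 0 1.
  by have := homog_emb iota 1 (piece1 G); rewrite muln0 rmorph1.
apply: val_inj; rewrite (grcompE 0 (homog_decomp_monom (ltn0Sn 0) h1)).
  by rewrite coefZ coefXn mulr1.
by rewrite hornerZ hornerXn expr1n mulr1.
Qed.

Variables (p : nat) (pR : p \in [pchar R]).

Let pL : p \in [pchar L]. Proof. exact: (rmorph_pchar emb). Qed.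

(** Roots exist in L and are unique, and Frobenius is a ring morphism, so the elements whose p^e-th
    roots lie in R^+GR form a subring. It contains the generators: a root of an element of degree
    k/N is homogeneous of degree k/(N p^e). *)
Lemma plusGR_root e (y z : L) :
  y \in plusGR_pred G iota -> z ^+ (p ^ e) = y -> z \in plusGR_pred G iota.
Proof.
pose Q y := forall z, z ^+ (p ^ e) = y -> z \in plusGR_pred G iota.
pose Qp : {pred L} := fun y => `[< Q y >].
have q0 : (0 < p ^ e)%N by rewrite expn_gt0 prime_gt0 // (pcharf_prime pR).
have root (u : L) : exists w, w ^+ (p ^ e) = u.
  have /closed_rootP[w /rootP] : size ('X^(p ^ e) - u%:P) != 1%N.
    by rewrite size_XnsubC // eqSS -lt0n.
  by rewrite hornerD hornerN hornerXn hornerC => /eqP; rewrite subr_eq0 => /eqP; exists w.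
have Qc : subring_closed Qp.
  split=> [|u v /asboolP Qu /asboolP Qv|u v /asboolP Qu /asboolP Qv]; apply/asboolP => w wE.
  - suff -> : w = 1 by apply: rpred1.
    by apply: (frobenius_inj pL (e := e)); rewrite wE expr1n.
  - have [u' u'E] := root u; have [v' v'E] := root v.
    suff -> : w = u' - v' by apply: rpredB; [apply: Qu|apply: Qv].
    apply: (frobenius_inj pL (e := e)); rewrite wE -u'E -v'E.
    by rewrite -(frobenius_zmod pL e u' v').
  - have [u' u'E] := root u; have [v' v'E] := root v.
    suff -> : w = u' * v' by apply: rpredM; [apply: Qu|apply: Qv].
    by apply: (frobenius_inj pL (e := e)); rewrite wE -u'E -v'E exprMn.
pose QS : subringClosed L := HB.pack Qp (GRing.isSubringClosed.Build L Qp Qc).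
move=> yS; move: z; suff /asboolP : y \in QS by [].
have /asboolP := yS; apply => f; rewrite inE => -[d [d0 fd]].
apply/asboolP => z zf.
have [N [k [N0 fh]]] := GR_homogeneous_ge0 d0 fd.
have := homog_scale (p ^ e) fh; rewrite /homog -zf exprM -exprZn.
move=> /(integralOver_exp q0); apply: homog_plusGR.
by rewrite muln_gt0 N0.
Qed.

End GradedPlusComponents.

(** * Components of high degree in R^+GR, and graded-plus closure *)

Section GradedPlusClosure.
Variables (K : fieldType) (R : idomAlgType K) (G : standard_grading R).
Variables (L : closedFieldType) (iota : {rmorphism {fraction R} -> L}).
Variables (p : nat) (pR : p \in [pchar R]).

Local Notation emb := (frac_emb iota).
Local Notation S := (subring (plusGR_pred G iota)).

(** Reducing f^n by the equation of f respects degrees. As t does not depend on n, all the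
    coefficients have high degree once n is large. *)
Lemma GR_homogeneous_exp a f : GR_homogeneous G iota a%:R f ->
  exists t, forall n, exists b : 'I_t -> R,
    (forall j : 'I_t, (j <= n)%N -> b j \in G (a * (n - j))%N) /\
    f ^+ n = \sum_j emb (b j) * f ^+ j.
Proof.
move=> [t [r [rG f0]]]; exists t => n.
(* For j > n the difference n - j would truncate to 0, so the coefficient is required to vanish;
   otherwise multiplication by a form would not preserve [Q]. *)
pose Q n y := exists b : 'I_t -> R,
  (forall j : 'I_t, if (j <= n)%N then b j \in G (a * (n - j))%N else b j == 0) /\
  y = \sum_j emb (b j) * f ^+ j.
suff Qf : Q n (f ^+ n).
  have [b [bG fE]] := Qf; exists b; split=> // j jn.
  by have := bG j; rewrite jn.
have Q0 m : Q m 0.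
  exists (fun=> 0); split=> [j|]; first by case: ifP => //; rewrite rpred0.
  by rewrite big1 // => j _; rewrite rmorph0 mul0r.
have QB m y z : Q m y -> Q m z -> Q m (y - z).
  move=> [b [bG ->]] [c [cG ->]]; exists (fun j => b j - c j); split=> [j|].
    have := bG j; have := cG j; case: ifP => _; first by move=> ? ?; rewrite rpredB.
    by move=> /eqP -> /eqP ->; rewrite subrr.
  by rewrite -sumrB; apply: eq_bigr => j _; rewrite rmorphB mulrBl.
have QD m y z : Q m y -> Q m z -> Q m (y + z).
  by move=> Qy Qz; rewrite -[z]opprK -[- z]sub0r; apply: (QB m) => //; apply: (QB m).
have QM m i y s : (i <= m)%N -> s \in G (a * i)%N -> Q (m - i)%N y -> Q m (emb s * y).
  move=> i_m sG [b [bG ->]]; exists (fun j => s * b j); split=> [j|].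
    have := bG j; case: (leqP j (m - i)) => jn.
      move=> bjG; have -> : (j <= m)%N by lia.
      by have := piece_mul sG bjG; congr (_ \in G _); nia.
    by move=> /eqP ->; rewrite mulr0; case: ifP => // _; rewrite rpred0.
  by rewrite mulr_sumr; apply: eq_bigr => j _; rewrite rmorphM mulrA.
elim/ltn_ind: n => n IH; have [nt|tn] := ltnP n t.
  exists (fun j => (j == Ordinal nt)%:R); split=> [j|].
    case: eqP => [->|jn] /=; first by rewrite leqnn subnn muln0 piece1.
    by case: ifP => // _; rewrite rpred0.
  rewrite (bigD1 (Ordinal nt)) //= eqxx rmorph1 mul1r big1 ?addr0 // => j /negPf ->.
  by rewrite rmorph0 mul0r.
have -> : f ^+ n = 0 - \sum_(1 <= i < t.+1) emb (r i) * f ^+ (n - i).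
  apply/eqP; rewrite sub0r -addr_eq0 -[n in f ^+ n](subnK tn) exprD.
  rewrite (eq_big_nat _ _ (F2 := fun i => f ^+ (n - t) * (emb (r i) * f ^+ (t - i)))).
    by rewrite -mulr_sumr -mulrDr f0 mulr0.
  by move=> i /andP[_ it]; rewrite mulrCA -exprD; congr (_ * _ ^+ _); lia.
apply: QB => //; rewrite big_nat; elim/big_ind: _ => // [y z|i /andP[i1 it]].
  exact: QD.
have i_n : (i <= n)%N by lia.
apply: QM i_n _ (IH _ _); last by lia.
have [->|[m [am rm]]] := rG i (introT andP (conj i1 it)); first exact: rpred0.
by move: am; rewrite -natrM => /eqP; rewrite eqr_nat mulnC => /eqP ->.
Qed.

(* A suitable power f^q lies in the ideal generated by the q-th powers of the
   [xs_l^k]; taking q-th roots gives the claim for f. *)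
Lemma grcomp_powers (xs : seq R) k a (x : S) :
  {subset xs <= G 1%N} -> (forall D r, r \in G D -> form_in G xs D r) ->
  (size xs * k < a)%N ->
  exists b : 'I_(size xs) -> S, grcomp a x = \sum_(l < size xs) plusGR_emb G iota (xs`_l ^+ k) * b l.
Proof.
move=> xsG xsF ka; set f := grcomp a x.
have fa : GR_homogeneous G iota a%:R (val f).
  by have := homog_GR_homogeneous (ltn0Sn 0) (grcomp_homog a x); rewrite divr1.
have [t ft] := GR_homogeneous_exp fa.
(* The choice ensures q > a t. With n = [size xs] and a >= n k + 1, the coefficient of f^j has
   degree a (q - j) >= (n k + 1) q - a t > n k q, as the pigeonhole requires. *)
pose q := (p ^ (a * t))%N.
have p1 : (1 < p)%N by rewrite prime_gt1 // (pcharf_prime pR).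
have qt : (a * t < q)%N by apply: ltn_expl.
have [b [bG fq]] := ft q.
have bxs (j : 'I_t) : exists c : 'I_(size xs) -> R, b j = \sum_(l < size xs) xs`_l ^+ (k * q) * c l.
  have jt : (a * j <= a * t)%N by rewrite leq_mul2l ltnW ?orbT.
  have jq : (j <= q)%N by apply: (leq_trans _ (ltnW qt)); nia.
  apply: (form_in_powers _ (xsF _ _ (bG j jq))).
  have kaq : ((size xs * k).+1 * q <= a * q)%N by rewrite leq_mul2r ka orbT.
  rewrite mulnBr mulnA ltn_subRL; apply: leq_trans kaq.
  by rewrite mulSn ltn_add2r (leq_ltn_trans jt qt).
have [c cE] := choice bxs.
have root (u : L) : exists w, w ^+ q = u.
  have /closed_rootP[w /rootP] : size ('X^q - u%:P) != 1%N.
    by rewrite size_XnsubC ?eqSS -?lt0n //; lia.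
  by rewrite hornerD hornerN hornerXn hornerC => /eqP; rewrite subr_eq0 => /eqP; exists w.
pose y (l : 'I_(size xs)) : S := \sum_j plusGR_emb G iota (c j l) * f ^+ j.
have yroot l : exists z : S, val z ^+ q = val (y l).
  have [z zE] := root (val (y l)).
  by exists (Subring (plusGR_root pR (valP (y l)) zE)).
have [z zE] := choice yroot.
exists z; apply: val_inj.
have pL : p \in [pchar L] by exact: (rmorph_pchar emb).
apply: (frobenius_inj pL (e := (a * t)%N)); rewrite -/q fq.
have emb_exp (r : R) : emb (r ^+ k) ^+ q = emb (r ^+ (k * q)).
  by rewrite -rmorphXn -exprM.
have valE : val (\sum_(l < size xs) plusGR_emb G iota (xs`_l ^+ k) * z l)
    = \sum_(l < size xs) emb (xs`_l ^+ k) * val (z l).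
  by rewrite raddf_sum.
have yE l : val (y l) = \sum_j emb (c j l) * val f ^+ j.
  by rewrite raddf_sum; apply: eq_bigr => j _; rewrite -rmorphXn.
rewrite valE -[RHS]/(frobenius pL (a * t)%N _) raddf_sum.
rewrite [RHS](eq_bigr (fun l : 'I_(size xs) =>
    \sum_j emb (xs`_l ^+ (k * q)) * (emb (c j l) * val f ^+ j))) => [|l _]; last first.
  by rewrite -mulr_sumr -yE -zE -emb_exp -exprMn.
rewrite exchange_big; apply: eq_bigr => j _.
rewrite cE rmorph_sum mulr_suml; apply: eq_bigr => l _.
by rewrite rmorphM mulrA.
Qed.

Theorem tight_closure_sub_graded_plus_closure :
  (forall (M' : lmodType R) (gM : int -> {pred M'}) (N' : submodClosed M'),
     graded_module G gM -> graded_submod gM N' ->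
     fin_gen M' -> fin_gen (submod N') ->
     coprimary (irrelevant_ideal G) (modquot N') ->
     forall u, tight_closure pR N' u -> graded_plus_closure G iota N' u) ->
  forall (M : lmodType R) (N : submodClosed M), fin_gen M ->
    coprimary (irrelevant_ideal G) (modquot N) ->
    forall u, tight_closure pR N u -> graded_plus_closure G iota N u.
Proof.
move=> hyp M N fgM cN u uN.
have [k kN] := coprimary_power cN.
have [xs [xsG xsF]] := piece_form_in G.
have [|||||||[] //] := @tight_closure_sub_extension K R G unit (fun=> S)
  (fun=> plusGR_emb G iota) (fun _ a => grcomp (G := G) (iota := iota) a) _ _ _ _ M N
  (size xs * k).+1 _ _ p pR _ fgM u uN => //.
- by move=> _ a b s; apply: grcomp_grcomp.
- by move=> _ a d r s; apply: grcompM.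
- by move=> _ a d r s; apply: grcompM_lt.
- by move=> _; apply: grcomp1.
- move=> _ a s m ka; have [b bE] := grcomp_powers s xsG xsF ka.
  rewrite [X in tcls _ _ X _]bE.
  by apply: tcls_sum_vanish => l; apply/kN/xsG/mem_nth.
- move=> M' gM N' gMM gN fM' fN' cN' v vN; exists tt; exact: hyp gMM gN fM' fN' cN' v vN.
Qed.

Lemma homog_integral N k x : homog G iota N k x -> integralOver emb x.
Proof.
move=> /(@integral_rmorph _ _ _ _ (horner_eval 1)) [P Pm].
rewrite /= /horner_eval hornerZ hornerXn expr1n mulr1 => Px; exists P => //.
by move: Px; rewrite (@eq_map_poly _ _ _ emb) // => r; apply: rho1E.
Qed.

Lemma plusGR_integral x : x \in plusGR_pred G iota -> x \in plus_pred iota.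
Proof.
move=> /asboolP; apply => f; rewrite inE => -[d [d0 fd]].
have [N [k [_ /homog_integral fi]]] := GR_homogeneous_ge0 d0 fd.
exact/asboolP.
Qed.

Lemma graded_plus_closure_sub_plus_closure (M : lmodType R) (N : submodClosed M) u :
  graded_plus_closure G iota N u -> plus_closure iota N u.
Proof.
apply: (extension_closure_comp
  (psi := corestr (f := val : {rmorphism S -> L}) (fun x => plusGR_integral (valP x)))).
by move=> r; apply: val_inj.
Qed.

End GradedPlusClosure.

Theorem theorem3p5 (K : fieldType) (p : nat) (pK : p \in [pchar K]) :
  (forall (R : comAlgType K) (G : standard_grading R),
     reduced_ring R -> perfect_field K p ->
     (forall (M : lmodType R) (gM : int -> {pred M}) (N : submodClosed M),
        graded_module G gM -> graded_submod gM N ->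
        fin_gen M -> fin_gen (submod N) ->
        coprimary (irrelevant_ideal G) (modquot N) ->
        tight_closure (pchar_algebra R pK) N
          = frobenius_closure (pchar_algebra R pK) N) ->
     forall (M : lmodType R) (N : submodClosed M),
       fin_gen M -> fin_gen (submod N) ->
       coprimary (irrelevant_ideal G) (modquot N) ->
       tight_closure (pchar_algebra R pK) N
         = frobenius_closure (pchar_algebra R pK) N)
  /\
  (forall (R : idomAlgType K) (G : standard_grading R)
     (L : closedFieldType) (iota : {rmorphism {fraction R} -> L}),
     algebraic_closure iota -> GRing.closed_field_axiom K ->
     (forall (M : lmodType R) (gM : int -> {pred M}) (N : submodClosed M),
        graded_module G gM -> graded_submod gM N ->
        fin_gen M -> fin_gen (submod N) ->
        coprimary (irrelevant_ideal G) (modquot N) ->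
        tight_closure (pchar_algebra R pK) N = plus_closure iota N /\
        plus_closure iota N = graded_plus_closure G iota N) ->
     forall (M : lmodType R) (N : submodClosed M),
       fin_gen M -> fin_gen (submod N) ->
       coprimary (irrelevant_ideal G) (modquot N) ->
       tight_closure (pchar_algebra R pK) N = plus_closure iota N /\
       plus_closure iota N = graded_plus_closure G iota N).
Proof.
split=> [R G _ _ hyp M N fgM _ cN|R G L iota _ _ hyp M N fgM _ cN].
  apply/seteqP; split=> u; last exact: frobenius_closure_sub_tight_closure.
  apply: (tight_closure_sub_frobenius_closure (G := G)) => //.
  by move=> M' gM N' gMM gN fM' fN' cN' v; rewrite (hyp M' gM N').
(* This closes the cycle of inclusions from graded-plus to plus to tight closure, so all three
   coincide. *)
have tight_gr : forall u, tight_closure (pchar_algebra R pK) N u ->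
    graded_plus_closure G iota N u.
  apply: tight_closure_sub_graded_plus_closure => //.
  move=> M' gM N' gMM gN fM' fN' cN' v.
  by have [-> ->] := hyp M' gM N' gMM gN fM' fN' cN'.
split; apply/seteqP; split=> u.
- by move=> /tight_gr; apply: graded_plus_closure_sub_plus_closure.
- exact: plus_closure_sub_tight_closure.
- move=> uN; apply: tight_gr; exact: plus_closure_sub_tight_closure uN.
- exact: graded_plus_closure_sub_plus_closure.
Qed.
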